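(* Let $\{X_k\}$ be the explosive PAR(1) time series of the context (with $|\phi|>1$), and for $r=1,\dots,P$ let $$\widehat a_r=\frac{\sum_{j=0}^{n-1}X_{jP+r-1}X_{jP+r}}{\sum_{j=0}^{n-1}(X_{jP+r-1})^2}$$ be the least squares estimator of $a_r$ based on $X_0,\dots,X_{nP}$. Then: (1) Conditionally on $X_0+\zeta\neq 0$, $\widehat a_r$ converges to $a_r$ almost surely as $n\to\infty$, for $r=1,\dots,P$. (2) Assume furthermore that $\mathrm P[X_0+\zeta=0]=0$ and that the strong mixing condition $\lim_{n\to\infty}\alpha(n)=0$ is fulfilled. Then, as $n\to\infty$, the random vector of scaled errors $\{\phi^n(\widehat a_r-a_r):r=1,\dots,P\}$ converges in distribution to $$\left\{\frac{(\phi^2-1)\,\zeta_r^*}{A_1^{r-1}(X_0+\zeta)}:r=1,\dots,P\right\},$$ where the random vector $(\zeta_1^*,\dots,\zeta_P^* )$ is independent of $(X_0,\zeta)$ and its distribution is that of $$\left(\sum_{j=1}^{\infty}\phi^{-j}u^*_{jP-r}:r=1,\dots,P\right).$$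
   Context: Model. All random variables are defined on a probability space $(\Omega,\mathcal F,\mathrm P)$. $P>0$ is an integer, $\{a_k\}$ is a $P$-periodic sequence of real numbers ($a_{k+P}=a_k$), and $\{u_k\}_{k\in\mathbb Z}$ is a sequence of real centered random variables with finite second moments that is periodically distributed with period $P$: $(u_{P+s},\dots,u_{P+r})$ has the same law as $(u_s,\dots,u_r)$ for all integers $s\le r$. The $u_k$ are not assumed independent or uncorrelated. $X_0$ is a square integrable random variable, and $X_k=a_kX_{k-1}+u_k$ for $k=1,2,\dots$. Notation. $A_s^{s-1}=1$ and $A_s^r=\prod_{j=s}^r a_j$ for $1\le s\le r$; $\phi=A_1^P=\prod_{r=1}^Pa_r$. It is assumed that $|\phi|>1$. For $r=1,\dots,P$, $U_n^{(r)}=\sum_{s=1}^rA_{s+1}^r u_{nP+s}$, and $Z_n=\sum_{l=0}^n\phi^{-l-1}U_l^{(P)}$. The random variable $\zeta=\lim_{n\to\infty}Z_n$ is the limit of $Z_n$ almost surely and in quadratic mean (this limit exists). Mixing coefficient. $\alpha(n)=\sup|\mathrm P[A\cap B]-\mathrm P[A]\mathrm P[B]|$, the supremum being over all $k\in\mathbb N$ and all $A\in\mathcal F^k$, $B\in\mathcal F_{k+n}$, where $\mathcal F^k=\sigma(X_0,u_j:j\le k)$ and $\mathcal F_{k+n}=\sigma(u_j:j\ge k+n)$. Reversed sequence. The probability space is assumed rich enough to carry a sequence $\{u_k^*\}_{k\ge0}$, independent of $(X_0,\{u_k\})$, such that $(u_0^*,\dots,u_{nP-1}^* )$ has the same law as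 $(u_{nP},u_{nP-1},\dots,u_1)$ for every integer $n>1$. Convention. ''Conditionally on $X_0+\zeta\ne0$, the sequence converges almost surely'' means that convergence holds at almost every point of the event $\{X_0+\zeta\neq0\}$. *)

(* Defs.v *)
From HB Require Import structures.
From mathcomp Require Import all_boot all_order all_algebra.
From mathcomp Require Import all_classical all_reals all_analysis.

Set Implicit Arguments.
Unset Strict Implicit.
Unset Printing Implicit Defensive.

Import Order.TTheory GRing.Theory Num.Theory.
Import numFieldNormedType.Exports.

Local Open Scope classical_set_scope.
Local Open Scope ring_scope.

Definition sigma_rv (d : measure_display) (T : measurableType d) (R : realType)
    (I : Type) (D : set I) (Y : I -> T -> R) : set (set T) :=
  <<s \bigcup_(i in D) preimage_set_system setT (Y i) measurable >>.

Definition independent_rv (d : measure_display) (T : measurableType d)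
    (R : realType) (Pr : probability T R) (I J : Type)
    (Y : I -> T -> R) (W : J -> T -> R) : Prop :=
  forall A B : set T, sigma_rv setT Y A -> sigma_rv setT W B ->
    (Pr (A `&` B) = Pr A * Pr B)%E.

(* The sigma-algebra on n.-tuple R is the product one, i.e., the Borel sets
   of R^n. *)
Definition same_law (d : measure_display) (T : measurableType d) (R : realType)
    (Pr : probability T R) (n : nat) (Y W : 'I_n -> T -> R) : Prop :=
  forall B : set (n.-tuple R), measurable B ->
    Pr [set w | B [tuple Y i w | i < n]] = Pr [set w | B [tuple W i w | i < n]].

Definition cvg_in_distribution (d : measure_display) (T : measurableType d)
    (R : realType) (Pr : probability T R) (m : nat)
    (Y : nat -> 'I_m -> T -> R) (Yoo : 'I_m -> T -> R) : Prop :=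
  forall f : 'rV[R]_m -> R, continuous f -> bounded_fun f ->
    ('E_Pr[fun w => f (\row_i Y n i w)])%E @[n --> \oo]
      --> ('E_Pr[fun w => f (\row_i Yoo i w)])%E.

(* The window (u_s, ..., u_r), s <= r, has length n.+1 with r = s + n. *)
Definition periodically_distributed (d : measure_display) (T : measurableType d)
    (R : realType) (Pr : probability T R) (p : nat) (u : int -> T -> R) : Prop :=
  forall (s : int) (n : nat),
    same_law Pr (fun i : 'I_n.+1 => u (p%:Z + s + i%:Z))
                (fun i : 'I_n.+1 => u (s + i%:Z)).

Fixpoint par1 (T : Type) (R : realType) (a : nat -> R) (u : int -> T -> R)
    (X0 : T -> R) (k : nat) (w : T) : R :=
  if k is k'.+1 then a k * par1 a u X0 k' w + u k%:Z w else X0 w.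

Definition Aprod (R : realType) (a : nat -> R) (s r : nat) : R :=
  \prod_(s <= j < r.+1) a j.

Definition phi (R : realType) (p : nat) (a : nat -> R) : R := Aprod a 1 p.

Definition Useq (T : Type) (R : realType) (p : nat) (a : nat -> R)
    (u : int -> T -> R) (r n : nat) (w : T) : R :=
  \sum_(1 <= s < r.+1) Aprod a s.+1 r * u (n * p + s)%N%:Z w.

Definition Zseq (T : Type) (R : realType) (p : nat) (a : nat -> R)
    (u : int -> T -> R) (n : nat) (w : T) : R :=
  \sum_(0 <= l < n.+1) phi p a ^- l.+1 * Useq p a u p l w.

Definition lse (T : Type) (R : realType) (p : nat) (X : nat -> T -> R)
    (r n : nat) (w : T) : R :=
  (\sum_(0 <= j < n) X (j * p + r - 1)%N w * X (j * p + r)%N w)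
  / \sum_(0 <= j < n) X (j * p + r - 1)%N w ^+ 2.

(* The family consisting of X_0, at index None, and of u_j, at index Some j *)
Definition adjoin (T : Type) (R : realType) (X0 : T -> R) (u : int -> T -> R)
    (o : option int) : T -> R :=
  if o is Some j then u j else X0.

Definition past (d : measure_display) (T : measurableType d) (R : realType)
    (X0 : T -> R) (u : int -> T -> R) (k : nat) : set (set T) :=
  sigma_rv [set o | if o is Some j then j <= k%:Z else true] (adjoin X0 u).

Definition future (d : measure_display) (T : measurableType d) (R : realType)
    (u : int -> T -> R) (k : nat) : set (set T) :=
  sigma_rv [set j | k%:Z <= j] u.

Definition mixing_coef (d : measure_display) (T : measurableType d)
    (R : realType) (Pr : probability T R) (X0 : T -> R) (u : int -> T -> R)
    (n : nat) : R :=
  sup [set x | exists (k : nat) (A B : set T),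
    [/\ past X0 u k A, future u (k + n) B &
        x = `|fine (Pr (A `&` B)) - fine (Pr A) * fine (Pr B)|]].

Definition reversed_sequence (d : measure_display) (T : measurableType d)
    (R : realType) (Pr : probability T R) (p : nat) (X0 : T -> R)
    (u : int -> T -> R) (ustar : nat -> T -> R) : Prop :=
  independent_rv Pr ustar (adjoin X0 u) /\
  forall n : nat, (1 < n)%N ->
    same_law Pr (fun i : 'I_(n * p) => ustar i)
                (fun i : 'I_(n * p) => u (n * p - i)%N%:Z).

(* When 1 < |phi| and the ustar_k are bounded in L^1, the series converges
   absolutely almost surely, so the default value that limn takes at divergent
   points does not affect its law. *)
Definition zeta_star (T : Type) (R : realType) (p : nat) (a : nat -> R)
    (ustar : nat -> T -> R) (r : nat) (w : T) : R :=
  limn (fun n : nat =>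
    \sum_(1 <= j < n.+1) phi p a ^- j * ustar (j * p - r)%N w).

(* Main.v *)
Require Import Defs.
From mathcomp Require Import all_boot all_order all_algebra.
From mathcomp Require Import all_classical all_reals all_analysis.
From mathcomp Require Import measurable_realfun.
From mathcomp Require Import ring lra.
Import Order.TTheory GRing.Theory Num.Theory.
Import numFieldNormedType.Exports.
Local Open Scope classical_set_scope.
Local Open Scope ring_scope.

(** The proof has a pathwise part and a distributional part.

    Pathwise part. The noise is bounded in mean, since it has periodic law and
    finite second moments; hence, almost surely, it grows more slowly than any
    geometric sequence ([mean_le_geoO]). Fix such a path, and write
    [phi = phi p a] and [V = A_1^(r-1) * (X_0 + zeta)]. Then
    [X_(jP+r-1) / phi^j] tends to [V] geometrically fast, at the rate
    [rho / |phi|] for some [rho > 1] with [rho^2 < |phi|] ([geoO_par1]).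
    The error of the estimator is the ratio of
    [sum_j X_(jP+r-1) * u_(jP+r)] to [sum_j X_(jP+r-1)^2]. Rescaled
    by [phi^-n] and [phi^-2n], the numerator and the denominator satisfy
    contracting affine recursions, and comparing these with the recursions of
    their expected limits ([geoO_rec]) gives
    [phi^n * (ahat_r - a_r) - (phi^2 - 1) * Y_n / V --> 0], where
    [Y_n = sum_(j < n) phi^-(n-j) * u_(jP+r)] ([ls_error], [lse_error]). As
    [Y_n] grows more slowly than [phi^n], consistency follows ([lse_cvg]).

    Distributional part. By time reversal, the vector of the [Y_n] has the law of
    a partial sum of the series that defines [zeta^*], and it is close in mean
    to the part of it that involves only the last few noise variables. By strong
    mixing that part is nearly independent of every event of a fixed past, so
    that [Y_n] is asymptotically independent of each such event
    ([recent_mixing]). On the other hand [1 / (X_0 + zeta)] is the almost sure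
    limit of [1 / (X_0 + Z_l)], which depends on the past alone, and which
    rounding to a finite grid replaces by a finite partition into past events.
    Tightness of [Y_n] allows one to pass to the limit in [l] uniformly in [n]
    ([mixing_limit]). Rounding to a grid is also what converts the mixing
    condition, which is about events, into a bound on covariances of bounded
    functions ([covariance_level_sets]); the same bound, with mixing coefficient
    [0], deals with the independence in the limit law. *)

Set Implicit Arguments.
Unset Strict Implicit.
Unset Printing Implicit Defensive.

(** * Geometric bounds *)

(** [s] is [O(mu^n)], with the bound holding for all indices. *)
Definition geoO (R : realType) (mu : R) (s : nat -> R) : Prop :=
  exists C : R, forall n, `|s n| <= C * mu ^+ n.

Lemma geoO_ge0 (R : realType) (mu : R) (s : nat -> R) :
  geoO mu s -> exists2 C : R, 0 <= C & forall n, `|s n| <= C * mu ^+ n.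
Proof.
move=> [C hC]; exists C => //.
by have := hC 0%N; rewrite expr0 mulr1; apply: le_trans.
Qed.

Lemma geoO_le (R : realType) (mu nu : R) (s : nat -> R) :
  0 <= mu <= nu -> geoO mu s -> geoO nu s.
Proof.
move=> /andP[mu0 munu] /geoO_ge0[C C0 hC]; exists C => n.
apply: (le_trans (hC n)); apply: ler_wpM2l => //.
by rewrite lerXn2r ?nnegrE// (le_trans mu0).
Qed.

Lemma geoOD (R : realType) (mu : R) (s t : nat -> R) :
  geoO mu s -> geoO mu t -> geoO mu (fun n => s n + t n).
Proof.
move=> [C hC] [D hD]; exists (C + D) => n.
by rewrite mulrDl (le_trans (ler_normD _ _))// lerD.
Qed.

Lemma geoOM (R : realType) (mu nu : R) (s t : nat -> R) :
  geoO mu s -> geoO nu t -> geoO (mu * nu) (fun n => s n * t n).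
Proof.
move=> [C hC] [D hD]; exists (C * D) => n.
by rewrite normrM exprMn mulrACA ler_pM.
Qed.

Lemma geoOZ (R : realType) (mu c : R) (s : nat -> R) :
  geoO mu s -> geoO mu (fun n => c * s n).
Proof.
move=> [C hC]; exists (`|c| * C) => n.
by rewrite normrM -mulrA ler_wpM2l.
Qed.

Lemma geoO_cvg0 (R : realType) (mu : R) (s : nat -> R) :
  0 <= mu < 1 -> geoO mu s -> s n @[n --> \oo] --> 0.
Proof.
move=> /andP[mu0 mu1] [C hC].
have h : C * mu ^+ n @[n --> \oo] --> (0 : R).
  rewrite -[X in _ --> X](mulr0 C); apply: cvgM; first exact: cvg_cst.
  by apply: cvg_expr; rewrite ger0_norm.
apply/cvgr0Pnorm_lt => e e0.
have := h => /cvgr0Pnorm_lt /(_ e e0); apply: filterS => n.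
by apply: le_lt_trans; rewrite (le_trans (hC n)) ?ler_norm.
Qed.

(** The solution of a contracting affine recursion grows no faster than its
    forcing term, provided that the latter decays more slowly than the
    homogeneous solution. *)
Lemma geoO_rec (R : realType) (lam mu : R) (b s : nat -> R) :
  `|lam| < mu -> geoO mu b ->
  (forall n, s n.+1 = lam * (s n + b n)) -> geoO mu s.
Proof.
move=> lammu /geoO_ge0[K K0 hK] hs.
have mu0 : 0 < mu by rewrite (le_lt_trans _ lammu).
have d0 : 0 < mu - `|lam| by rewrite subr_gt0.
exists (`|s 0%N| + `|lam| * K / (mu - `|lam|)).
elim=> [|n IH].
  by rewrite expr0 mulr1 lerDl divr_ge0 ?mulr_ge0// ltW.
set C := _ + _ in IH *.
have hC : `|lam| * (C + K) <= mu * C.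
  have : `|lam| * K / (mu - `|lam|) <= C by rewrite /C lerDr.
  by rewrite ler_pdivrMr// ; lra.
have -> : C * mu ^+ n.+1 = mu * C * mu ^+ n by rewrite exprS; ring.
rewrite hs normrM.
apply: (@le_trans _ _ (`|lam| * ((C + K) * mu ^+ n))).
  rewrite ler_wpM2l// mulrDl (le_trans (ler_normD _ _))// lerD//.
by rewrite mulrA ler_wpM2r// exprn_ge0// ltW.
Qed.

(** A sequence with geometrically small increments tends to its limit at the same
    geometric rate. *)
Lemma geoO_tail (R : realType) (th l : R) (z : nat -> R) :
  0 <= th < 1 -> geoO th (fun n => z n.+1 - z n) -> z n @[n --> \oo] --> l ->
  geoO th (fun n => z n - l).
Proof.
move=> /andP[th0 th1] /geoO_ge0[K K0 hK] zl.
have d0 : 0 < 1 - th by rewrite subr_gt0.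
exists (K / (1 - th)) => n.
have h m : `|z n - z (n + m)%N| <= K / (1 - th) * th ^+ n * (1 - th ^+ m).
  elim: m => [|m IH]; first by rewrite addn0 subrr normr0 expr0 subrr mulr0.
  have -> : z n - z (n + m.+1)%N =
    (z n - z (n + m)%N) - (z (n + m).+1 - z (n + m)%N) by rewrite addnS; ring.
  rewrite (le_trans (ler_normB _ _))//.
  apply: (le_trans (lerD IH (hK _))).
  rewrite exprD exprS le_eqVlt; apply/orP; left; apply/eqP.
  by field; rewrite gt_eqF.
have hl : `|z n - z (n + m)%N| @[m --> \oo] --> `|z n - l|.
  apply: cvg_norm; apply: cvgB; first exact: cvg_cst.
  have := zl; rewrite -(cvg_shiftn n) /=; under eq_fun do rewrite addnC; exact.
apply: (cvgr_to_le hl).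
near=> m; apply: (le_trans (h m)).
rewrite -[leRHS]mulr1 ler_wpM2l//; last by rewrite gerBl exprn_ge0.
by rewrite mulr_ge0 ?exprn_ge0// divr_ge0// ltW.
Unshelve. all: by end_near. Qed.

(** The sum of the [e j] for [j < n], discounted geometrically backwards from [n]. *)
Definition geo_sum (R : realType) (phi : R) (e : nat -> R) (n : nat) : R :=
  \sum_(0 <= j < n) phi ^- (n - j) * e j.

Lemma geo_sumS (R : realType) (phi : R) (e : nat -> R) (n : nat) :
  geo_sum phi e n.+1 = phi^-1 * (geo_sum phi e n + e n).
Proof.
rewrite /geo_sum big_nat_recr//= subSnn expr1 mulrDr; congr (_ + _).
rewrite mulr_sumr; apply: eq_big_nat => j /andP[_ jn].
by rewrite subSn ?(ltnW jn)// exprS invfM mulrA.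
Qed.

Lemma geoO_geo_sum (R : realType) (phi rho : R) (e : nat -> R) :
  1 < `|phi| -> 1 < rho -> geoO rho e -> geoO rho (geo_sum phi e).
Proof.
move=> phi1 rho1 he; apply: (geoO_rec (lam := phi^-1) _ he (geo_sumS phi e)).
by rewrite (lt_trans _ rho1)// normfV invf_lt1// (lt_trans _ phi1).
Qed.

(** The error of a least squares quotient with explosive regressors [x] and noise
    [e]. The condition [rho ^+ 2 < `|phi|] makes the product of the noise with the
    deviation of [x j / phi ^+ j] from [V] geometrically small. *)
Lemma ls_error (R : realType) (phi rho V : R) (x e : nat -> R) :
  1 < rho -> rho ^+ 2 < `|phi| -> V != 0 -> geoO rho e ->
  geoO (rho / `|phi|) (fun j => x j / phi ^+ j - V) ->
  phi ^+ n * ((\sum_(0 <= j < n) x j * e j) / \sum_(0 <= j < n) x j ^+ 2)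
    - (phi ^+ 2 - 1) * geo_sum phi e n / V
    @[n --> \oo] --> 0.
Proof.
move=> rho1 rho2phi V0 he hx.
have rho0 : 0 < rho by rewrite (lt_trans _ rho1).
have phi0 : 0 < `|phi| by rewrite (lt_trans _ rho2phi)// exprn_gt0.
have pn0 : phi != 0 by rewrite -normr_gt0.
have phi1 : 1 < `|phi| by rewrite (lt_trans _ rho2phi)// exprn_egt1.
have rhophi : rho < `|phi| by rewrite (lt_trans _ rho2phi)// ltr_eXnr.
set th := rho / `|phi|.
have th0 : 0 < th by rewrite divr_gt0.
have th1 : th < 1 by rewrite ltr_pdivrMr// mul1r.
have thrho1 : th * rho < 1 by rewrite /th mulrAC ltr_pdivrMr// mul1r -expr2.
have qth : `|phi^-1| < th by rewrite normfV /th ltr_pMl ?invr_gt0.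
(* The normalized numerator [N], denominator [D] and its expected limit [d]. *)
pose v n := x n / phi ^+ n.
pose Y := geo_sum phi e.
pose N n := phi ^- n * \sum_(0 <= j < n) x j * e j.
pose D n := phi ^- (2 * n) * \sum_(0 <= j < n) x j ^+ 2.
pose d := V ^+ 2 / (phi ^+ 2 - 1).
have phi2 : phi ^+ 2 - 1 != 0.
  by rewrite subr_eq0 gt_eqF// -real_normK ?num_real// exprn_egt1.
have d0 : d != 0 by rewrite mulf_neq0 ?invr_eq0// sqrf_eq0.
have hYS n : Y n.+1 = phi^-1 * (Y n + e n) by exact: geo_sumS.
have hNS n : N n.+1 = phi^-1 * (N n + v n * e n).
  rewrite /N big_nat_recr//= exprS invfM /v; field; rewrite pn0 ?expf_neq0//.
have hDS n : D n.+1 = phi ^- 2 * (D n + v n ^+ 2).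
  rewrite /D big_nat_recr//= mulnS exprD invfM /v (mulnC 2) exprM; field.
  by rewrite pn0 expf_neq0.
have hY : geoO rho Y by exact: geoO_geo_sum.
have hR : geoO (th * rho) (fun n => N n - V * Y n).
  apply: (geoO_rec (lam := phi^-1) (b := fun n => (v n - V) * e n)).
  - by rewrite (lt_trans qth)// ltr_pMr.
  - exact: geoOM.
  - by move=> n; rewrite hNS hYS; ring.
have hv : geoO th (fun n => v n ^+ 2 - V ^+ 2).
  suff : geoO th (fun n => (v n - V) * (v n - V) + (2 * V) * (v n - V)).
    by move=> [C hC]; exists C => n; apply: le_trans (hC n);
       rewrite le_eqVlt; apply/orP; left; apply/eqP; congr `|_|; ring.
  apply: geoOD; last exact: geoOZ.
  apply: (@geoO_le _ (th * th)); last exact: geoOM.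
  by rewrite mulr_ge0 ?ltW//= gtr_pMl.
have hd : geoO th (fun n => D n - d).
  apply: (geoO_rec (lam := phi ^- 2) _ hv).
    rewrite normfV normrX -exprVn -normfV expr2 (lt_trans _ qth)//.
    by rewrite gtr_pMl ?normr_gt0 ?invr_eq0// (lt_trans qth).
  move=> n; rewrite hDS /d; field; exact/andP.
have hcvg0 s : geoO (th * rho) s -> s n @[n --> \oo] --> 0.
  by apply: geoO_cvg0; rewrite mulr_ge0 ?ltW.
have Dd : D n @[n --> \oo] --> d.
  have : D n - d @[n --> \oo] --> 0 by apply: geoO_cvg0 hd; rewrite ltW.
  by move/subr_cvg0.
have DVd : (D n)^-1 @[n --> \oo] --> d^-1 by apply: cvgV.
have hYd : geoO (th * rho) (fun n => (D n - d) * Y n) by exact: geoOM.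
have main : (N n - V * Y n) * (D n)^-1
    - (V / d) * ((D n - d) * Y n) * (D n)^-1 @[n --> \oo] -->
    (0 * d^-1 - (V / d) * 0 * d^-1 : R).
  apply: cvgB; first by apply: cvgM => //; exact: hcvg0.
  by apply: cvgM => //; apply: cvgM; [exact: cvg_cst|exact: hcvg0].
rewrite mulr0 !mul0r subr0 in main.
apply: cvg_trans main; apply: near_eq_cvg.
have : \forall n \near \oo, D n != 0.
  by apply: (cvgr_neq0 _ Dd).
apply: filterS => n Dn0.
have hn : phi ^+ n * ((\sum_(0 <= j < n) x j * e j) / \sum_(0 <= j < n) x j ^+ 2)
   = N n / D n.
  rewrite /N /D mulnC exprM expr2 !invfM !invrK; field.
  rewrite expf_neq0// andbT; apply/eqP => h.
  by move: Dn0; rewrite /D h mulr0 eqxx.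
rewrite hn -/(Y n) /d; field.
by rewrite Dn0 phi2 V0.
Qed.

(** * Pathwise behaviour of the autoregression *)

(** The denominator of the estimator eventually does not vanish, so that the
    convention on division by zero plays no role in the limit. *)
Lemma sum_sqr_neq0 (R : realType) (phi V : R) (x : nat -> R) :
  V != 0 -> x j / phi ^+ j @[j --> \oo] --> V ->
  \forall n \near \oo, \sum_(0 <= j < n) x j ^+ 2 != 0.
Proof.
move=> V0 xV; have [N _ hN] : \forall j \near \oo, x j / phi ^+ j != 0.
  exact: (cvgr_neq0 _ xV).
exists N.+1 => // n /= Nn.
rewrite psumr_neq0; last by move=> *; exact: sqr_ge0.
apply/hasP; exists N; first by rewrite mem_index_iota.
have := hN N (leqnn N); rewrite /= lt0r sqr_ge0 andbT sqrf_eq0.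
by apply: contraNneq => ->; rewrite mul0r.
Qed.

Section PathwisePAR.
Context (T : Type) (R : realType) (p : nat) (a : nat -> R) (u : int -> T -> R)
        (X0 : T -> R).
Hypothesis a_periodic : forall k : nat, a (k + p)%N = a k.

Lemma a_block (n r : nat) : a (n * p + r)%N = a r.
Proof.
by elim: n => [|n IH]; rewrite ?mul0n// mulSn -addnA addnC a_periodic.
Qed.

Lemma Aprod_recr (s r : nat) : (s <= r.+1)%N ->
  Aprod a s r.+1 = Aprod a s r * a r.+1.
Proof. by move=> sr; rewrite /Aprod big_nat_recr. Qed.

Lemma Aprod_nil (r : nat) : Aprod a r.+1 r = 1.
Proof. by rewrite /Aprod big_geq. Qed.

Lemma Aprod_neq0 (r : nat) : phi p a != 0 -> (r <= p)%N -> Aprod a 1 r != 0.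
Proof.
move=> phi0 rp; apply: contraNneq phi0 => h.
by rewrite /phi /Aprod (big_cat_nat (n := r.+1))//= -/(Aprod a 1 r) h mul0r.
Qed.

Lemma Useq_recr (r n : nat) (w : T) :
  Useq p a u r.+1 n w = a r.+1 * Useq p a u r n w + u (n * p + r.+1)%N%:Z w.
Proof.
rewrite /Useq big_nat_recr//= Aprod_nil mul1r mulr_sumr; congr (_ + _).
apply: eq_big_nat => s /andP[_ sr].
by rewrite Aprod_recr// mulrAC mulrC mulrA.
Qed.

(** Within a period, the process is an affine function of its value at the
    beginning of the period. *)
Lemma par1_block (n r : nat) (w : T) :
  par1 a u X0 (n * p + r)%N w
  = Aprod a 1 r * par1 a u X0 (n * p)%N w + Useq p a u r n w.
Proof.
elim: r => [|r IH].
  by rewrite addn0 Aprod_nil mul1r /Useq big_geq// addr0.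
rewrite {1}addnS /= IH Aprod_recr// Useq_recr -addnS a_block; ring.
Qed.

Lemma par1_period (n : nat) (w : T) : phi p a != 0 ->
  par1 a u X0 (n * p)%N w = phi p a ^+ n *
    (X0 w + \sum_(0 <= l < n) phi p a ^- l.+1 * Useq p a u p l w).
Proof.
move=> phi0; elim: n => [|n IH].
  by rewrite mul0n /= big_geq// addr0 mul1r.
rewrite mulSnr par1_block IH big_nat_recr//= -/(phi p a) !exprS; field.
by rewrite phi0 expf_neq0.
Qed.

Variables (rho zeta : R) (w : T).
Hypotheses (rho1 : 1 < rho) (rho2phi : rho ^+ 2 < `|phi p a|)
  (hu : forall s, (1 <= s <= p)%N -> geoO rho (fun j => u (j * p + s)%N%:Z w))
  (hZ : Zseq p a u n w @[n --> \oo] --> zeta) (p0 : (0 < p)%N).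

Lemma geoO_Useq (r : nat) : (r <= p)%N -> geoO rho (fun n => Useq p a u r n w).
Proof.
elim: r => [|r IH] rp.
  exists 0 => n; rewrite /Useq big_geq// normr0 mul0r//.
have := geoOD (geoOZ (a r.+1) (IH (ltnW rp))) (@hu r.+1 rp).
by move=> [C hC]; exists C => n; rewrite Useq_recr.
Qed.

Let rho0 : 0 < rho. Proof. exact: lt_trans rho1. Qed.

Lemma phi_gt1_of_rho : 1 < `|phi p a|.
Proof. by rewrite (lt_trans _ rho2phi)// exprn_egt1. Qed.

Let phi0 : 0 < `|phi p a|. Proof. exact: lt_trans phi_gt1_of_rho. Qed.

Let pn0 : phi p a != 0. Proof. by rewrite -normr_gt0. Qed.

Let th1 : 0 <= rho / `|phi p a| < 1.
Proof.
rewrite divr_ge0 ?ltW//= ltr_pdivrMr// mul1r (lt_trans _ rho2phi)//.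
by rewrite ltr_eXnr.
Qed.

Lemma geoO_ratio (s : nat -> R) : geoO rho s ->
  geoO (rho / `|phi p a|) (fun n => s n / phi p a ^+ n).
Proof.
move=> [C hC]; exists C => n.
rewrite normrM normfV normrX expr_div_n mulrA ler_pM2r ?invr_gt0 ?exprn_gt0//.
Qed.

(** The partial sums on the left run over [l < n], one term fewer than [Zseq]. *)
Lemma geoO_Z :
  geoO (rho / `|phi p a|)
    (fun n => \sum_(0 <= l < n) phi p a ^- l.+1 * Useq p a u p l w - zeta).
Proof.
apply: (@geoO_tail _ _ zeta
  (fun n => \sum_(0 <= l < n) phi p a ^- l.+1 * Useq p a u p l w)) => //.
  have [C hC] := geoOZ (phi p a)^-1 (geoO_ratio (geoO_Useq (leqnn p))).
  exists C => n; apply: le_trans (hC n).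
  rewrite big_nat_recr//= addrAC subrr add0r exprS invfM.
  by rewrite -mulrA [X in _ * X]mulrC.
by rewrite -cvg_shiftS; exact: hZ.
Qed.

Hypothesis V0 : X0 w + zeta != 0.

Lemma geoO_par1 (r : nat) : (r <= p)%N ->
  geoO (rho / `|phi p a|) (fun j => par1 a u X0 (j * p + r)%N w / phi p a ^+ j
    - Aprod a 1 r * (X0 w + zeta)).
Proof.
move=> rp; have := geoOD (geoOZ (Aprod a 1 r) geoO_Z)
                         (geoO_ratio (geoO_Useq rp)).
move=> [C hC]; exists C => n; apply: le_trans (hC n).
rewrite par1_block par1_period// le_eqVlt; apply/orP; left; apply/eqP.
by congr `|_|; field; rewrite expf_neq0.
Qed.

(** Pathwise expansion of the scaled error of the least squares estimator. *)
Lemma lse_error (r : nat) : (1 <= r <= p)%N ->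
  phi p a ^+ n * (lse p (par1 a u X0) r n w - a r)
    - (phi p a ^+ 2 - 1) * geo_sum (phi p a) (fun j => u (j * p + r)%N%:Z w) n
      / (Aprod a 1 r.-1 * (X0 w + zeta)) @[n --> \oo] --> 0.
Proof.
case: r => // r /andP[_ rp] /=.
have V'0 : Aprod a 1 r * (X0 w + zeta) != 0.
  by rewrite mulf_neq0// Aprod_neq0// ltnW.
have hx := geoO_par1 (ltnW rp).
have := ls_error rho1 rho2phi V'0 (hu (s := r.+1) rp) hx.
apply: cvg_trans; apply: near_eq_cvg.
have : \forall n \near \oo,
    \sum_(0 <= j < n) par1 a u X0 (j * p + r)%N w ^+ 2 != 0.
  apply: (sum_sqr_neq0 V'0); apply/subr_cvg0; exact: geoO_cvg0 th1 hx.
apply: filterS => n Dn0.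
congr (_ * _ - _); rewrite /lse.
set x := fun j => par1 a u X0 (j * p + r)%N w in Dn0 *.
pose e j := u (j * p + r.+1)%N%:Z w.
have -> : \sum_(0 <= j < n) par1 a u X0 (j * p + r.+1 - 1) w *
    par1 a u X0 (j * p + r.+1) w
    = \sum_(0 <= j < n) x j * (a r.+1 * x j + e j).
  by apply: eq_bigr => j _; rewrite addnS subn1 /= -addnS a_block.
have -> : \sum_(0 <= j < n) par1 a u X0 (j * p + r.+1 - 1) w ^+ 2
    = \sum_(0 <= j < n) x j ^+ 2.
  by apply: eq_bigr => j _; rewrite addnS subn1.
apply: (mulIf Dn0); rewrite mulrBl !mulfVK// mulr_sumr -sumrB.
apply: eq_bigr => j _; rewrite -/(x j) -/(e j); ring.
Qed.

(** Pathwise consistency. *)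
Lemma lse_cvg (r : nat) : (1 <= r <= p)%N ->
  lse p (par1 a u X0) r n w @[n --> \oo] --> a r.
Proof.
move=> hr; apply/subr_cvg0.
have hY : geoO rho (geo_sum (phi p a) (fun j => u (j * p + r)%N%:Z w)).
  by apply: geoO_geo_sum => //; [exact: phi_gt1_of_rho|exact: hu].
have hY0 := geoO_cvg0 th1 (geoO_ratio hY).
have hinv : (phi p a)^-1 ^+ n @[n --> \oo] --> (0 : R).
  by apply: cvg_expr; rewrite normfV invf_lt1// phi_gt1_of_rho.
set Y := geo_sum (phi p a) _ in hY hY0.
set c := (phi p a ^+ 2 - 1) / (Aprod a 1 r.-1 * (X0 w + zeta)).
have main : (phi p a)^-1 ^+ n * (phi p a ^+ n *
    (lse p (par1 a u X0) r n w - a r)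
    - (phi p a ^+ 2 - 1) * Y n / (Aprod a 1 r.-1 * (X0 w + zeta)))
    + c * (Y n / phi p a ^+ n) @[n --> \oo] --> (0 * 0 + c * 0 : R).
  apply: cvgD; first by apply: cvgM hinv _; exact: lse_error.
  exact: cvgM (cvg_cst _) hY0.
rewrite !mulr0 addr0 in main; apply: cvg_trans main; apply: near_eq_cvg.
apply: nearW => n; rewrite exprVn /c; field.
rewrite expf_neq0// V0 Aprod_neq0//.
by case/andP: hr => _; apply: leq_trans; rewrite leq_pred.
Qed.

End PathwisePAR.

(** * Expectations of bounded measurable functions *)

Section BoundedMeasurable.
Context (d : measure_display) (T : measurableType d) (R : realType).
Implicit Types (f g h : T -> R) (A : set T).

(** Bounded measurable functions. *)
Definition bmeas h : Prop :=
  measurable_fun setT h /\ exists M : R, forall w, `|h w| <= M.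

Lemma bmeas_mfun h : bmeas h -> measurable_fun setT h.
Proof. by case. Qed.

Lemma bmeas_cst (c : R) : bmeas (fun _ => c).
Proof. by split; [exact: measurable_cst|exists `|c|]. Qed.

Lemma bmeasD f g : bmeas f -> bmeas g -> bmeas (fun w => f w + g w).
Proof.
move=> [mf [M hM]] [mg [N hN]]; split; first exact: measurable_funD.
by exists (M + N) => w; rewrite (le_trans (ler_normD _ _))// lerD.
Qed.

Lemma bmeasM f g : bmeas f -> bmeas g -> bmeas (fun w => f w * g w).
Proof.
move=> [mf [M hM]] [mg [N hN]]; split; first exact: measurable_funM.
by exists (M * N) => w; rewrite normrM ler_pM.
Qed.

Lemma bmeasB f g : bmeas f -> bmeas g -> bmeas (fun w => f w - g w).
Proof.
move=> bf bg; have := bmeasD bf (bmeasM (bmeas_cst (-1)) bg).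
by congr bmeas; apply/funext => w; rewrite mulN1r.
Qed.

Lemma bmeas_norm f : bmeas f -> bmeas (fun w => `|f w|).
Proof.
move=> [mf [M hM]]; split; first exact: measurableT_comp.
by exists M => w; rewrite normr_id.
Qed.

Lemma bmeas_indic A : measurable A -> bmeas (\1_A : T -> R).
Proof.
move=> mA; split; first exact: measurable_indic.
by exists 1 => w; rewrite indicE; case: (_ \in _); rewrite ?normr0 ?normr1.
Qed.

Lemma bmeas_sum (n : nat) (F : nat -> T -> R) :
  (forall k, bmeas (F k)) -> bmeas (fun w => \sum_(0 <= k < n) F k w).
Proof.
move=> bF; elim: n => [|n IH].
  rewrite (_ : (fun _ => _) = cst 0); first exact: bmeas_cst.
  by apply/funext => w; rewrite big_geq.
have := bmeasD IH (bF n); congr bmeas.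
by apply/funext => w; rewrite big_nat_recr.
Qed.

End BoundedMeasurable.

Section BoundedExpectation.
Context (d : measure_display) (T : measurableType d) (R : realType)
        (Pr : probability T R).
Implicit Types (f g h : T -> R) (A : set T).

Lemma bmeas_integrable h : bmeas h -> Pr.-integrable setT (EFin \o h).
Proof.
move=> [mh [M hM]]; apply: measurable_bounded_integrable => //.
  by rewrite (le_lt_trans (probability_le1 _ _))// ltry.
by exists M; split; [exact: num_real|move=> x Mx w _; exact: le_trans (ltW Mx)].
Qed.

Lemma expectation_bmeas h : bmeas h -> ('E_Pr[h] = (\int[Pr]_w h w)%:E)%E.
Proof.
move=> bh; rewrite unlock /Rintegral fineK//.
exact: integrable_fin_num (bmeas_integrable bh).
Qed.

Lemma bRintegralD f g : bmeas f -> bmeas g ->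
  \int[Pr]_w (f w + g w) = \int[Pr]_w f w + \int[Pr]_w g w.
Proof. by move=> bf bg; apply: RintegralD => //; exact: bmeas_integrable. Qed.

Lemma bRintegralB f g : bmeas f -> bmeas g ->
  \int[Pr]_w (f w - g w) = \int[Pr]_w f w - \int[Pr]_w g w.
Proof. by move=> bf bg; apply: RintegralB => //; exact: bmeas_integrable. Qed.

Lemma bRintegralZ (c : R) f : bmeas f ->
  \int[Pr]_w (c * f w) = c * \int[Pr]_w f w.
Proof. by move=> bf; apply: RintegralZl => //; exact: bmeas_integrable. Qed.

Lemma bRintegral_le f g : bmeas f -> bmeas g -> (forall w, f w <= g w) ->
  \int[Pr]_w f w <= \int[Pr]_w g w.
Proof.
by move=> bf bg fg; apply: le_Rintegral => //; exact: bmeas_integrable.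
Qed.

Lemma bRintegral_norm f : bmeas f ->
  `|\int[Pr]_w f w| <= \int[Pr]_w `|f w|.
Proof. by move=> bf; apply: le_normr_Rintegral => //; exact: bmeas_integrable. Qed.

Lemma bRintegral_cst (c : R) : \int[Pr]_w c = c.
Proof. by rewrite Rintegral_cst//= probability_setT mulr1. Qed.

Lemma bRintegral_indic A : measurable A -> \int[Pr]_w (\1_A w : R) = fine (Pr A).
Proof. by move=> mA; rewrite /Rintegral integral_indic// setIT. Qed.

Lemma bRintegral_bound f (M : R) : measurable_fun setT f ->
  (forall w, `|f w| <= M) -> `|\int[Pr]_w f w| <= M.
Proof.
move=> mf fM; have bf : bmeas f by split => //; exists M.
rewrite (le_trans (bRintegral_norm bf))// -[leRHS]bRintegral_cst.
by apply: bRintegral_le => //; [exact: bmeas_norm|exact: bmeas_cst].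
Qed.

Lemma bRintegral_sum (n : nat) (F : nat -> T -> R) :
  (forall k, bmeas (F k)) ->
  \int[Pr]_w (\sum_(0 <= k < n) F k w) = \sum_(0 <= k < n) \int[Pr]_w F k w.
Proof.
move=> bF; elim: n => [|n IH].
  rewrite big_geq//; under eq_Rintegral do rewrite big_geq//.
  exact: bRintegral_cst.
under eq_Rintegral do rewrite big_nat_recr//=.
by rewrite bRintegralD ?IH ?big_nat_recr//; exact: bmeas_sum.
Qed.

Lemma bRintegral_cvg (h_ : nat -> T -> R) h (M : R) :
  (forall n, measurable_fun setT (h_ n)) -> measurable_fun setT h ->
  (forall n w, `|h_ n w| <= M) ->
  {ae Pr, forall w, h_ n w @[n --> \oo] --> h w} ->
  \int[Pr]_w h_ n w @[n --> \oo] --> \int[Pr]_w h w.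
Proof.
move=> mh_ mh hM hcvg.
have [|||||/integrable_fin_num fh _ hc] :=
  @dominated_convergence _ T R Pr setT measurableT (fun n => EFin \o h_ n)
  (EFin \o h) (cst M%:E).
- by move=> n; exact/measurable_EFinP.
- exact/measurable_EFinP.
- by apply: filterS hcvg => w hw _ /=; apply/fine_cvgP; split => //; exact: nearW.
- exact/bmeas_integrable/bmeas_cst.
- by apply: aeW => w n _ /=; rewrite lee_fin.
have := hc; rewrite -[X in _ --> X]fineK ?fh//.
by move=> /fine_cvgP[].
Qed.

(** A function bounded by [M], and by [e] outside [A], has a mean of absolute
    value at most [e + M * Pr A]. *)
Lemma bRintegral_split f (M e : R) A : measurable_fun setT f -> 0 <= e ->
  measurable A -> (forall w, `|f w| <= M) -> (forall w, ~ A w -> `|f w| <= e) ->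
  `|\int[Pr]_w f w| <= e + M * fine (Pr A).
Proof.
move=> mf e0 mA fM fe; have bf : bmeas f by split => //; exists M.
rewrite (le_trans (bRintegral_norm bf))//.
rewrite -(bRintegral_indic mA) -(bRintegralZ _ (bmeas_indic _ mA)).
rewrite -{1}(bRintegral_cst e).
have bA := bmeasM (bmeas_cst _ M) (@bmeas_indic _ _ R A mA).
rewrite -bRintegralD//; last exact: bmeas_cst.
apply: bRintegral_le; first exact: bmeas_norm.
  by apply: bmeasD => //; exact: bmeas_cst.
move=> w; rewrite indicE; case: (boolP (w \in A)) => [_|/negP wA].
  by rewrite mulr1 (le_trans (fM w))// lerDr.
by rewrite mulr0 addr0 fe// => Aw; apply: wA; rewrite inE.
Qed.

End BoundedExpectation.

(** * Row vectors, quantization and continuous functions *)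

Lemma cvg_sumr (R : realType) (I : Type) (r : seq I) (F : I -> nat -> R)
    (l : I -> R) :
  (forall i, F i n @[n --> \oo] --> l i) ->
  \sum_(i <- r) F i n @[n --> \oo] --> \sum_(i <- r) l i.
Proof.
move=> hF; elim: r => [|i r IH].
  rewrite big_nil; under eq_fun do rewrite big_nil; exact: cvg_cst.
rewrite big_cons; under eq_fun do rewrite big_cons.
by apply: cvgD IH.
Qed.

(** Componentwise convergence implies convergence of row vectors. *)
Lemma cvg_row (R : realType) (m : nat) (y_ : nat -> 'I_m -> R) (y : 'I_m -> R) :
  (forall i, y_ n i @[n --> \oo] --> y i) ->
  \row_i y_ n i @[n --> \oo] --> \row_i y i.
Proof.
move=> hy; apply/cvgrPdist_lt => e e0.
have : \forall n \near \oo, forall j, `|y j - y_ n j| < e.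
  by apply: filter_forall => k; move: (hy k) => /cvgrPdist_lt; exact.
apply: filterS => n hn.
rewrite /Num.norm /= mx_normrE; apply/bigmax_ltP; split => // -[i j] _ /=.
by rewrite !mxE.
Qed.

Lemma continuous_row_cvg (R : realType) (m : nat) (f : 'rV[R]_m -> R)
    (y_ : nat -> 'I_m -> R) (y : 'I_m -> R) :
  continuous f -> (forall i, y_ n i @[n --> \oo] --> y i) ->
  f (\row_i y_ n i) @[n --> \oo] --> f (\row_i y i).
Proof.
move=> cf hy; apply: (cvg_comp (fun n => \row_i y_ n i) f (cvg_row hy)).
exact: cf.
Qed.

(** The number of the cell containing [x] in the grid of mesh [1 / (l + 1)]
    that starts at [- l]. All numbers above [l] share the last cell; all numbers
    below [- l] share cell [0], as [Num.truncn] sends negative numbers to [0]. *)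
Definition cell (R : realType) (l : nat) (x : R) : nat :=
  minn (Num.truncn ((x + l%:R) * l.+1%:R)) (2 * l * l.+1).

(** The left end of the cell number [k]. *)
Definition cell_value (R : realType) (l k : nat) : R := k%:R / l.+1%:R - l%:R.

(** Rounding of [x] down to the grid, with values clamped to [- l] and [l]. *)
Definition quantize (R : realType) (l : nat) (x : R) : R :=
  cell_value R l (cell l x).

Lemma cell_lt (R : realType) (l : nat) (x : R) :
  (cell l x < (2 * l * l.+1).+1)%N.
Proof. by rewrite ltnS geq_minr. Qed.

Lemma measurable_cell (R : realType) (l : nat) :
  measurable_fun setT (@cell R l).
Proof.
have hge k : measurable [set x : R | (k <= cell l x)%N].
  case: k => [|k].
    by rewrite [X in measurable X](_ : _ = setT)//; apply/seteqP; split.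
  have [kN|kN] := leqP k.+1 (2 * l * l.+1); last first.
    rewrite [X in measurable X](_ : _ = set0)//; apply/seteqP; split => //= x.
    by move=> h; have := leq_trans kN (leq_trans h (geq_minr _ _)); rewrite ltnn.
  rewrite [X in measurable X](_ : _ = `[cell_value R l k.+1, +oo[%classic)//.
  apply/seteqP; split => x; rewrite /= in_itv/= andbT leq_min kN andbT;
    by rewrite truncn_gt_nat lerBlDr ler_pdivrMr.
have heq k : measurable [set x : R | cell l x = k].
  rewrite [X in measurable X](_ : _ = [set x : R | (k <= cell l x)%N] `\`
     [set x : R | (k.+1 <= cell l x)%N]); first exact: measurableD.
  apply/seteqP; split => x /=; first by move=> ->; rewrite leqnn ltnn.
  by move=> [h1 /negP]; rewrite -leqNgt => h2; apply/eqP; rewrite eqn_leq h1 h2.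
move=> _ B _; rewrite setTI.
rewrite [X in measurable X](_ : _ = \bigcup_(k in B) [set x : R | cell l x = k]).
  exact: bigcup_measurable.
by apply/seteqP; split => [x Bx|x [k Bk /= xk]]; [exists (cell l x)|rewrite /= xk].
Qed.

Lemma measurable_quantize (R : realType) (l : nat) :
  measurable_fun setT (@quantize R l).
Proof.
by apply: (measurableT_comp _ (@measurable_cell R l)) => _ B _.
Qed.

Lemma quantize_close (R : realType) (l : nat) (x : R) : `|x| <= l%:R ->
  `|quantize l x - x| <= l.+1%:R^-1.
Proof.
rewrite ler_norml => /andP[x1 x2]; rewrite /quantize /cell_value /cell.
have l0 : 0 < l.+1%:R :> R by [].
set z := (x + l%:R) * l.+1%:R.
have z0 : 0 <= z by rewrite mulr_ge0// -lerBlDr sub0r.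
have zE : x = z / l.+1%:R - l%:R by rewrite /z; field; rewrite nat1r.
have -> : minn (Num.truncn z) (2 * l * l.+1) = Num.truncn z.
  apply/minn_idPl; rewrite -(@ler_nat R).
  apply: (@le_trans _ _ z); first by rewrite truncn_le.
  rewrite /z natrM ler_pM2r// natrM mulr_natl mulr2n; lra.
have /andP[t1 t2] := truncn_itv z0.
rewrite zE (_ : _ - _ = - (z - (Num.truncn z)%:R) / l.+1%:R); last by ring.
rewrite mulNr normrN normrM normfV (ger0_norm (ltW l0)) ler_piMl ?invr_ge0//.
rewrite ger0_norm ?subr_ge0//; move: t2; rewrite -natr1; lra.
Qed.

Lemma quantize_cvg (R : realType) (x_ : nat -> R) (x : R) :
  x_ l @[l --> \oo] --> x -> quantize l (x_ l) @[l --> \oo] --> x.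
Proof.
move=> hx; apply: (cvg_sub0 _ hx).
apply/cvgr0Pnorm_le => e e0; near=> l.
apply: (@le_trans _ _ l.+1%:R^-1).
  rewrite quantize_close//.
  have h1 : `|x_ l| <= `|x| + 1.
    rewrite -[x_ l](subrK x) (le_trans (ler_normD _ _))// addrC lerD2l ltW//.
    rewrite distrC; near: l; by move: hx => /cvgrPdist_lt; apply.
  apply: (le_trans h1); near: l; exact: nbhs_infty_ger.
by apply: ltW; near: l; exact: (near_infty_natSinv_lt (PosNum e0)).
Unshelve. all: by end_near. Qed.

(** A continuous function of finitely many measurable functions is measurable:
    it is the limit of functions of their quantizations, which have countable
    range. *)
Lemma measurable_continuous_row (d : measure_display) (T : measurableType d)
    (R : realType) (m : nat) (f : 'rV[R]_m -> R) (Y : 'I_m -> T -> R) :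
  continuous f -> (forall i, measurable_fun setT (Y i)) ->
  measurable_fun setT (fun w => f (\row_i Y i w)).
Proof.
move=> cf mY.
apply: (@measurable_fun_cvg _ _ _ _
   (fun l w => f (\row_i quantize l (Y i w)))); last first.
  move=> w _; apply: continuous_row_cvg => // i.
  by apply: quantize_cvg; exact: cvg_cst.
move=> l _ B _; rewrite setTI.
pose g (k : {ffun 'I_m -> nat}) := f (\row_i cell_value R l (k i)).
rewrite [X in measurable X](_ : _ = \bigcup_(k : {ffun 'I_m -> nat})
   if k \in [set k | B (g k)]
   then \bigcap_(i : 'I_m) (Y i @^-1` [set x | cell l x = k i]) else set0).
  apply: countable_bigcupT_measurable => [|k]; first exact: countableP.
  case: ifP => // _; apply: fin_bigcap_measurable => // i _.
  rewrite -[X in measurable X]setTI; apply: mY => //.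
  rewrite -[X in measurable X]setTI; exact: (@measurable_cell R l _ [set k i]).
apply/seteqP; split => [w Bw|w [k _]].
  exists [ffun i => cell l (Y i w)] => //; rewrite ifT; last first.
    rewrite inE /g /=; congr (B (f _)): Bw.
    by apply/rowP => i; rewrite !mxE ffunE.
  by move=> i _ /=; rewrite ffunE.
case: ifPn => // + hk; rewrite inE /g /=; congr (B (f _)).
by apply/rowP => i; rewrite !mxE /quantize hk.
Qed.

(** Uniform continuity of a continuous function near a cube, in coordinates. *)
Lemma continuous_row_unif (R : realType) (m : nat) (f : 'rV[R]_m -> R) (M e : R) :
  continuous f -> 0 < e ->
  exists2 dl : R, 0 < dl & forall x y : 'I_m -> R,
    (forall i, `|x i| <= M) -> (forall i, `|y i - x i| < dl) ->
    `|f (\row_i y i) - f (\row_i x i)| < e.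
Proof.
move=> cf e0.
pose K := [set v : 'rV[R]_m | forall i, `[- M, M]%classic (v ord0 i)].
have cK : compact K.
  by apply: (@rV_compact R m (fun=> `[- M, M]%classic)) => i; exact: segment_compact.
pose P (dl : R) (x : 'rV[R]_m) :=
  forall y : 'rV[R]_m, `|y - x| < dl -> `|f y - f x| < e.
have /compact_near_coveringP/(_ _ (0 : R)^'+ P _) hK := cK.
have hP : \forall dl \near (0 : R)^'+, K `<=` P dl.
  apply: hK => x _.
  have /cvgrPdist_lt/(_ (e / 2)) := cf x; rewrite divr_gt0// => /(_ isT).
  move=> /nbhs_ballP[r /= r0 hr].
  exists (ball x (r / 2), [set dl | dl < r / 2]).
    split => /=; first by apply: nbhsx_ballx; rewrite divr_gt0.
    by apply: nbhs_right_lt; rewrite divr_gt0.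
  move=> [x' dl] [/= xx' dlr] y yx'.
  have h1 : `|f x - f x'| < e / 2.
    apply: hr; apply: (le_ball _ xx'); lra.
  have h2 : `|f x - f y| < e / 2.
    apply: hr; rewrite (splitr r); apply: (ball_triangle xx').
    by rewrite -ball_normE /ball_ /= distrC (lt_trans yx').
  rewrite (splitr e) -(subrK (f x) (f y)) -addrA.
  by rewrite (le_lt_trans (ler_normD _ _))// ltrD// distrC.
have [dl [dl0 hdl]] : exists dl, 0 < dl /\ K `<=` P dl.
  near (0 : R)^'+ => dl; exists dl; split => //; near: dl.
  exact: hP.
exists dl => // x y xM yx; apply: hdl.
  by move=> i; rewrite /= mxE in_itv/= -ler_norml.
rewrite /Num.norm /= mx_normrE; apply/bigmax_ltP; split => // -[i j] _ /=.
by rewrite !mxE.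
Unshelve. all: by end_near. Qed.

(** * Covariance of an event and a bounded function *)

Section EventCovariance.
Context (d : measure_display) (T : measurableType d) (R : realType)
        (Pr : probability T R).
Implicit Types (A B : set T).

Lemma fine_Pr_le A B : measurable A -> measurable B -> A `<=` B ->
  fine (Pr A) <= fine (Pr B).
Proof.
move=> mA mB AB; apply: fine_le; rewrite ?fin_num_measure//.
by apply: le_measure; rewrite ?inE.
Qed.

Lemma fine_Pr_setU A B : measurable A -> measurable B ->
  fine (Pr (A `|` B)) <= fine (Pr A) + fine (Pr B).
Proof.
move=> mA mB; rewrite -fineD ?fin_num_measure//.
apply: fine_le; rewrite ?fin_numD ?fin_num_measure//; first exact: measurableU.
exact: measureU2.
Qed.

Lemma fine_Pr_ge0 A : 0 <= fine (Pr A).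
Proof. exact: fine_ge0. Qed.

Lemma fine_Pr_le1 A : measurable A -> fine (Pr A) <= 1.
Proof.
move=> mA; rewrite -[leRHS]/(fine 1%:E); apply: fine_le => //.
  by rewrite fin_num_measure.
exact: probability_le1.
Qed.

Lemma measurable_ge_set (g : T -> R) (c : R) : measurable_fun setT g ->
  measurable [set w | c <= g w].
Proof.
move=> mg; rewrite [X in measurable X](_ : _ = g @^-1` `[c, +oo[).
  by rewrite -[X in measurable X]setTI; exact: mg.
by apply/seteqP; split => w; rewrite /= in_itv/= andbT.
Qed.

Lemma measurable_gt_set (g : T -> R) (c : R) : measurable_fun setT g ->
  measurable [set w | c < g w].
Proof.
move=> mg; rewrite [X in measurable X](_ : _ = g @^-1` `]c, +oo[).
  by rewrite -[X in measurable X]setTI; exact: mg.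
by apply/seteqP; split => w; rewrite /= in_itv/= andbT.
Qed.

Lemma measurable_cell_set (g : T -> R) (l : nat) (D : set nat) :
  measurable_fun setT g -> measurable [set w | D (cell l (g w))].
Proof.
move=> mg; rewrite -[X in measurable X]setTI.
exact: (measurableT_comp (@measurable_cell R l) mg).
Qed.

Lemma ae_cvg0_in_probability (g : nat -> T -> R) (dl : R) :
  (forall n, measurable_fun setT (g n)) ->
  {ae Pr, forall w, g n w @[n --> \oo] --> 0} -> 0 < dl ->
  fine (Pr [set w | dl <= g n w]) @[n --> \oo] --> (0 : R).
Proof.
move=> mg hg dl0; rewrite -(bRintegral_cst Pr 0).
have mA n : measurable [set w | dl <= g n w] by exact: measurable_ge_set.
rewrite (_ : (fun _ => _) =
    (fun n => \int[Pr]_w (\1_[set w | dl <= g n w] w : R))); last first.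
  by apply/funext => n; rewrite bRintegral_indic.
apply: (@bRintegral_cvg _ _ _ _ _ _ 1).
- by move=> n; exact: measurable_indic.
- exact: measurable_cst.
- by move=> n w; rewrite indicE; case: (_ \in _); rewrite ?normr0 ?normr1.
- apply: filterS hg => w hw; apply: cvg_near_cst.
  move: hw => /cvgr0Pnorm_lt/(_ dl dl0); apply: filterS => n hn.
  rewrite indicE memNset//= leNgt; apply/negP; rewrite negbK.
  by rewrite (le_lt_trans _ hn)// ler_norm.
Qed.

(** If an event [A] is nearly independent, up to [al], of the upper level sets
    of a bounded function, then its covariance with the function is small: the
    quantization of the function is affine in the sum of the indicators of such
    sets. *)
Lemma covariance_level_sets A (h : T -> R) (al : R) (l : nat) :
  measurable A -> measurable_fun setT h -> (forall w, `|h w| <= l%:R) ->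
  (forall k : nat, let B := [set w | (k < cell l (h w))%N] in
    `|fine (Pr (A `&` B)) - fine (Pr A) * fine (Pr B)| <= al) ->
  `|\int[Pr]_w (\1_A w * h w) - fine (Pr A) * \int[Pr]_w h w|
    <= 2 * l%:R * al + 2 / l.+1%:R.
Proof.
move=> mA mh hl hal.
(* [L g] is the covariance of the event [A] and of [g]. *)
pose L (g : T -> R) := \int[Pr]_w (\1_A w * g w) - fine (Pr A) * \int[Pr]_w g w.
pose q w := quantize l (h w).
pose N := (2 * l * l.+1)%N.
pose B k := [set w | (k < cell l (h w))%N].
have mB k : measurable (B k) by exact: (measurable_cell_set l [set j | (k < j)%N]).
have bA := @bmeas_indic _ _ R _ mA.
have bB k := @bmeas_indic _ _ R _ (mB k).
have bh : bmeas h by split => //; exists l%:R.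
pose S w := \sum_(0 <= k < N) (\1_(B k) w : R).
have bS : bmeas S by exact: bmeas_sum.
have cellE w n : (cell l (h w) <= n)%N ->
    (cell l (h w))%:R = \sum_(0 <= k < n) (\1_(B k) w : R).
  elim: n => [|n IH] hn.
    by rewrite big_geq//; move: hn; rewrite leqn0 => /eqP ->.
  rewrite big_nat_recr//= indicE.
  move: hn; rewrite leq_eqVlt => /orP[/eqP hn|hn]; last first.
    by rewrite memNset ?addr0 ?IH// /B /=; apply/negP; rewrite -leqNgt.
  rewrite mem_set /B /= ?hn ?ltnSn// -natr1; congr (_ + _).
  rewrite (eq_big_nat _ _ (F2 := fun=> 1)) => [|k /andP[_ kn]].
    by rewrite sumr_const_nat subn0.
  by rewrite indicE mem_set// /B /= hn ltnS ltnW.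
have qE : q = (fun w => l.+1%:R^-1 * S w - l%:R).
  apply/funext => w; rewrite /q /quantize /cell_value mulrC; congr (_ * _ - _).
  by apply: cellE; exact: geq_minr.
have LB k : `|L (\1_(B k))| <= al.
  rewrite /L bRintegral_indic// (_ : (fun w => _) = \1_(A `&` B k)).
    by rewrite bRintegral_indic//; [exact: hal|exact: measurableI].
  by apply/funext => w; rewrite indicI.
have LD f g : bmeas f -> bmeas g -> L (fun w => f w + g w) = L f + L g.
  move=> bf bg; rewrite /L.
  under eq_Rintegral do rewrite mulrDr.
  rewrite !bRintegralD//; [ring|exact: bmeasM|exact: bmeasM].
have LZ c f : bmeas f -> L (fun w => c * f w) = c * L f.
  move=> bf; rewrite /L.
  under eq_Rintegral do rewrite mulrCA.
  rewrite !bRintegralZ//; [ring|exact: bmeasM].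
have LC c : L (fun _ => c) = 0.
  rewrite /L bRintegral_cst; under eq_Rintegral do rewrite mulrC.
  by rewrite bRintegralZ// bRintegral_indic// mulrC subrr.
have LS n : `|L (fun w => \sum_(0 <= k < n) (\1_(B k) w : R))| <= n%:R * al.
  elim: n => [|n IH].
    rewrite (_ : (fun _ => _) = fun=> 0) ?LC ?normr0 ?mul0r//.
    by apply/funext => w; rewrite big_geq.
  rewrite (_ : (fun _ => _) =
    fun w => \sum_(0 <= k < n) (\1_(B k) w : R) + \1_(B n) w).
    rewrite LD//; last exact: bmeas_sum.
    by rewrite (le_trans (ler_normD _ _))// -natr1 mulrDl mul1r lerD.
  by apply/funext => w; rewrite big_nat_recr.
have bq : bmeas q by rewrite qE; apply: bmeasB; [apply: bmeasM => //|];
  exact: bmeas_cst.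
have l0 : 0 < l.+1%:R :> R by [].
have Lq : `|L q| <= 2 * l%:R * al.
  rewrite qE (LD (fun w => l.+1%:R^-1 * S w) (fun=> - l%:R)); last 2 first.
  - by apply: bmeasM => //; exact: bmeas_cst.
  - exact: bmeas_cst.
  rewrite LC addr0 LZ// normrM normfV (ger0_norm (ltW l0)).
  by rewrite mulrC ler_pdivrMr// (le_trans (LS N))// /N !natrM mulrAC.
have Lhq : `|L (fun w => h w - q w)| <= 2 / l.+1%:R.
  have hq w : `|h w - q w| <= l.+1%:R^-1.
    by rewrite distrC /q quantize_close.
  have bhq : bmeas (fun w => h w - q w) by exact: bmeasB.
  rewrite /L (le_trans (ler_normB _ _))// mulr2n mulrDl mul1r lerD//.
    apply: bRintegral_bound; first by case: (bmeasM bA bhq).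
    move=> w; rewrite normrM indicE; case: (_ \in _);
      by rewrite ?normr1 ?normr0 ?mul1r ?mul0r ?invr_ge0 ?hq.
  rewrite normrM ger0_norm ?fine_Pr_ge0// -[leRHS]mul1r ler_pM//.
  - exact: fine_Pr_ge0.
  - exact: fine_Pr_le1.
  - by apply: bRintegral_bound => //; case: bhq.
rewrite -/(L h) (_ : L h = L (fun w => q w + (h w - q w))); last first.
  by congr L; apply/funext => w; rewrite addrC subrK.
by rewrite LD//; [rewrite (le_trans (ler_normD _ _))// lerD|exact: bmeasB].
Qed.

End EventCovariance.

(** * Tightness and the mixing limit theorem *)

Section MixingLimit.
Context (d : measure_display) (T : measurableType d) (R : realType)
        (Pr : probability T R) (m : nat).
Implicit Types (A B : set T) (Y G K : 'I_m -> T -> R) (f : 'rV[R]_m -> R).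

(** The l^1 norm of a random vector. *)
Definition l1norm (Y : 'I_m -> T -> R) (w : T) : R := \sum_(i < m) `|Y i w|.

(** Tightness from above of a sequence of real functions; for norms of random
    vectors this is the tightness of their laws. *)
Definition tight (S : nat -> T -> R) : Prop :=
  forall e : R, 0 < e -> exists b : R, forall n,
    fine (Pr [set w | b < S n w]) <= e.

Lemma measurable_l1norm Y : (forall i, measurable_fun setT (Y i)) ->
  measurable_fun setT (l1norm Y).
Proof.
by move=> mY; apply: measurable_sum => i; exact: measurableT_comp.
Qed.

Lemma ge_l1norm Y i w : `|Y i w| <= l1norm Y w.
Proof. by rewrite /l1norm (bigD1 i)//= lerDl sumr_ge0. Qed.

Lemma bmeas_row f Y : continuous f -> bounded_fun f ->
  (forall i, measurable_fun setT (Y i)) -> bmeas (fun w => f (\row_i Y i w)).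
Proof.
move=> cf [M [_ hM]] mY; split; first exact: measurable_continuous_row.
by exists (M + 1) => w; apply: hM => //; rewrite ltrDl.
Qed.

(** A bounded continuous function has nearly the same expectation at a random
    vector taken from a tight family and at any random vector that is close to
    it in probability. *)
Lemma tight_approx f (K : nat -> 'I_m -> T -> R) (e : R) :
  continuous f -> bounded_fun f -> (forall n i, measurable_fun setT (K n i)) ->
  tight (fun n => l1norm (K n)) -> 0 < e ->
  exists2 dl : R, 0 < dl & forall n G, (forall i, measurable_fun setT (G i)) ->
    fine (Pr [set w | dl <= l1norm (fun i w => G i w - K n i w) w]) <= dl ->
    `|\int[Pr]_w f (\row_i G i w) - \int[Pr]_w f (\row_i K n i w)| <= e.
Proof.
move=> cf bf mK tK e0.
have [M M0 fM] : exists2 M, 0 < M & forall v, `|f v| <= M.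
  have [M [_ hM]] := bf; exists (`|M| + 1); first by rewrite ltr_wpDl.
  by move=> v; apply: hM => //; rewrite (le_lt_trans (ler_norm _))// ltrDl.
have e1 : 0 < e / (6 * M) by rewrite divr_gt0// mulr_gt0.
have [b hb] := tK _ e1.
have [d0 d00 hd0] := continuous_row_unif b cf (divr_gt0 e0 (ltr0n _ 3)).
exists (Num.min d0 (e / (6 * M))) => [|n G mG hG]; first by rewrite lt_min d00.
set dl := Num.min _ _ in hG *.
pose D := fun i w => G i w - K n i w.
have mD i : measurable_fun setT (D i) by exact: measurable_funB.
pose A := [set w | b < l1norm (K n) w] `|` [set w | dl <= l1norm D w].
have mA1 : measurable [set w | b < l1norm (K n) w].
  by apply: measurable_gt_set; exact: measurable_l1norm.
have mA2 : measurable [set w | dl <= l1norm D w].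
  by apply: measurable_ge_set; exact: measurable_l1norm.
have mA : measurable A by exact: measurableU.
have bfG := bmeas_row cf bf mG; have bfK := bmeas_row cf bf (mK n).
rewrite -bRintegralB//.
have := @bRintegral_split _ _ _ Pr
  (fun w => f (\row_i G i w) - f (\row_i K n i w)) (2 * M) (e / 3) A.
move=> /(_ (bmeas_mfun (bmeasB bfG bfK)) (ltW (divr_gt0 e0 (ltr0n _ 3))) mA).
have h1 w : `|f (\row_i G i w) - f (\row_i K n i w)| <= 2 * M.
  by rewrite (le_trans (ler_normB _ _))// mulr2n mulrDl mul1r lerD.
have h2 w : ~ A w -> `|f (\row_i G i w) - f (\row_i K n i w)| <= e / 3.
  move=> /not_orP[/negP a1 /negP a2]; apply: ltW; apply: hd0 => i.
    by rewrite (le_trans (ge_l1norm (K n) i w))// leNgt.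
  rewrite (le_lt_trans (ge_l1norm D i w))//.
  by move: a2; rewrite -ltNge lt_min => /andP[].
move=> /(_ h1 h2) /le_trans; apply.
have : fine (Pr A) <= e / (6 * M) + e / (6 * M).
  apply: (le_trans (fine_Pr_setU _ mA1 mA2)); apply: lerD; first exact: hb.
  by apply: (le_trans hG); rewrite ge_min lexx orbT.
move=> /(ler_wpM2l (ltW (mulr_gt0 (ltr0n R 2) M0))).
rewrite (_ : 2 * M * (e / (6 * M) + e / (6 * M)) = 2 / 3 * e); last first.
  by field; rewrite gt_eqF.
by move=> h; rewrite (le_trans (lerD (lexx _) h))//; lra.
Qed.

Lemma tight_scale (Y : nat -> 'I_m -> T -> R) (eta : T -> R) :
  measurable_fun setT eta -> (forall n i, measurable_fun setT (Y n i)) ->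
  tight (fun n => l1norm (Y n)) ->
  tight (fun n => l1norm (fun i w => eta w * Y n i w)).
Proof.
move=> meta mY tY e e0.
have e20 : 0 < e / 2 by rewrite divr_gt0.
have [b hb] := tY _ e20.
have [k hk] : exists k : nat, fine (Pr [set w | 1 <= `|eta w| / k.+1%:R]) <= e / 2.
  have h : fine (Pr [set w | 1 <= `|eta w| / k.+1%:R]) @[k --> \oo] --> (0 : R).
    apply: ae_cvg0_in_probability => // [n|].
      by apply: measurable_funM => //; exact: measurableT_comp.
    apply: aeW => w; rewrite -[X in _ --> X](mulr0 `|eta w|).
    by apply: cvgM; [exact: cvg_cst|exact: cvg_harmonic].
  have /cvgr0Pnorm_lt/(_ _ e20)[k _ hk] := h.
  exists k; apply: ltW; apply: le_lt_trans (hk k (leqnn k)); exact: ler_norm.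
exists (k.+1%:R * Num.max b 0) => n.
have mA1 : measurable [set w | b < l1norm (Y n) w].
  by apply: measurable_gt_set; exact: measurable_l1norm.
have mA2 : measurable [set w | 1 <= `|eta w| / k.+1%:R].
  apply: measurable_ge_set; apply: measurable_funM => //.
  exact: measurableT_comp.
have h : [set w | k.+1%:R * Num.max b 0 < l1norm (fun i w => eta w * Y n i w) w]
   `<=` [set w | b < l1norm (Y n) w] `|` [set w | 1 <= `|eta w| / k.+1%:R].
  move=> w /=; apply: contraPP => /not_orP[/negP + /negP].
  rewrite -leNgt -ltNge ltr_pdivrMr// mul1r => h1 h2; apply/negP; rewrite -leNgt.
  rewrite /l1norm; under eq_bigr do rewrite normrM.
  rewrite -mulr_sumr -/(l1norm (Y n) w) ler_pM ?sumr_ge0 ?(ltW h2)//.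
  by rewrite le_max h1.
apply: (le_trans (fine_Pr_le Pr _ _ h)).
- apply: measurable_gt_set; apply: measurable_l1norm => i.
  exact: measurable_funM.
- exact: measurableU.
by rewrite (le_trans (fine_Pr_setU Pr mA1 mA2))// (splitr e) lerD.
Qed.

Variables (f : 'rV[R]_m -> R) (zs : 'I_m -> T -> R).
Hypotheses (cf : continuous f) (bf : bounded_fun f)
           (mzs : forall i, measurable_fun setT (zs i)).

(** The mean of [f] along the multiple [v] of the vector [zs]. *)
Definition scaled_mean (v : R) : R := \int[Pr]_w f (\row_i (v * zs i w)).

(** The function [f] precomposed with the homothety of ratio [v]. *)
Definition scaled_fun (v : R) (x : 'rV[R]_m) : R := f (v *: x).

Lemma continuous_scaled_fun (v : R) : continuous (scaled_fun v).
Proof.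
move=> x; rewrite /scaled_fun.
apply: (@continuous_comp _ _ _ (fun x : 'rV[R]_m => v *: x) f); last exact: cf.
exact: (@scaler_continuous _ _ v x).
Qed.

Lemma bounded_scaled_fun (v : R) : bounded_fun (scaled_fun v).
Proof.
have [M [Mr hM]] := bf; exists M; split => // M' MM' x _; exact: hM.
Qed.

Lemma row_scale (v : R) (Y : 'I_m -> T -> R) w :
  \row_i (v * Y i w) = v *: \row_i Y i w.
Proof. by apply/rowP => i; rewrite !mxE. Qed.

Lemma bounded_fun_norm_le : exists M, forall v, `|f v| <= M.
Proof.
have [M [_ hM]] := bf; exists (M + 1) => v; apply: hM => //.
by rewrite ltrDl.
Qed.

Lemma scaled_mean_cvg (v_ : nat -> R) (v : R) :
  v_ n @[n --> \oo] --> v -> scaled_mean (v_ n) @[n --> \oo] --> scaled_mean v.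
Proof.
move=> hv; have [M hM] := bounded_fun_norm_le.
apply: (@bRintegral_cvg _ _ _ _ _ _ M) => //.
- move=> n; apply: measurable_continuous_row => // i.
  by apply: measurable_funM => //.
- by apply: measurable_continuous_row => // i; exact: measurable_funM.
- apply: aeW => w; apply: continuous_row_cvg => // i.
  by apply: cvgM hv _; exact: cvg_cst.
Qed.

(** A strict upper bound on the cell numbers of the grid of level [l]. *)
Definition cell_count (l : nat) := (2 * l * l.+1).+1.

(** Decomposition of a function of a quantized variable over its cells. *)
Lemma quantize_sum (F : R -> R) (l : nat) (x : R) :
  F (quantize l x)
  = \sum_(0 <= k < cell_count l) \1_[set y : R | cell l y = k] x *
      F (cell_value R l k).
Proof.
rewrite (bigD1_seq (cell l x)) ?iota_uniq//=; last first.
  by rewrite mem_index_iota /= cell_lt.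
rewrite indicE mem_set//= mul1r big1 ?addr0// => k kx.
by rewrite indicE memNset ?mul0r//= => /eqP; rewrite eq_sym; exact/negP.
Qed.

(** The event that [eta] falls into the cell number [k]. *)
Definition cell_event (l k : nat) (eta : T -> R) := [set w | cell l (eta w) = k].

Lemma measurable_cell_event l k eta : measurable_fun setT eta ->
  measurable (cell_event l k eta).
Proof. by move=> me; exact: (measurable_cell_set l [set k] me). Qed.

Lemma f_quantize_sum (Y : 'I_m -> T -> R) (l : nat) (eta : T -> R) w :
  f (\row_i (quantize l (eta w) * Y i w))
  = \sum_(0 <= k < cell_count l)
       \1_(cell_event l k eta) w * scaled_fun (cell_value R l k) (\row_i Y i w).
Proof.
rewrite row_scale -/(scaled_fun _ _).
by rewrite (quantize_sum (fun v => scaled_fun v (\row_i Y i w))).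
Qed.

Lemma Rintegral_f_quantize (Y : 'I_m -> T -> R) (l : nat) (eta : T -> R) :
  measurable_fun setT eta -> (forall i, measurable_fun setT (Y i)) ->
  \int[Pr]_w f (\row_i (quantize l (eta w) * Y i w))
  = \sum_(0 <= k < cell_count l)
      \int[Pr]_w (\1_(cell_event l k eta) w *
        scaled_fun (cell_value R l k) (\row_i Y i w)).
Proof.
move=> me mY.
under eq_Rintegral do rewrite f_quantize_sum.
rewrite bRintegral_sum// => k.
apply: bmeasM; first exact/bmeas_indic/measurable_cell_event.
by apply: bmeas_row => //; [exact: continuous_scaled_fun|exact: bounded_scaled_fun].
Qed.

Lemma Rintegral_scaled_mean_quantize (l : nat) (eta : T -> R) :
  measurable_fun setT eta ->
  \int[Pr]_w scaled_mean (quantize l (eta w))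
  = \sum_(0 <= k < cell_count l) fine (Pr (cell_event l k eta)) *
      \int[Pr]_w scaled_fun (cell_value R l k) (\row_i zs i w).
Proof.
move=> me.
have scaled_meanE k : \int[Pr]_w scaled_fun (cell_value R l k) (\row_i zs i w)
    = scaled_mean (cell_value R l k).
  by apply: eq_Rintegral => w _; rewrite row_scale.
under eq_Rintegral do rewrite (quantize_sum scaled_mean).
rewrite bRintegral_sum; last first.
  move=> k; apply: bmeasM; last exact: bmeas_cst.
  exact/bmeas_indic/measurable_cell_event.
apply: eq_bigr => k _; rewrite scaled_meanE mulrC -bRintegral_indic; last first.
  exact: measurable_cell_event.
rewrite -bRintegralZ; last exact/bmeas_indic/measurable_cell_event.
by apply: eq_Rintegral => w _; rewrite mulrC.
Qed.

Lemma bmeas_scaled_mean_quantize (l : nat) (eta : T -> R) :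
  measurable_fun setT eta -> bmeas (fun w => scaled_mean (quantize l (eta w))).
Proof.
move=> me; rewrite (_ : (fun w => _) = fun w => \sum_(0 <= k < cell_count l)
   \1_(cell_event l k eta) w * scaled_mean (cell_value R l k)); last first.
  by apply/funext => w; rewrite (quantize_sum scaled_mean).
apply: bmeas_sum => k; apply: bmeasM; last exact: bmeas_cst.
exact/bmeas_indic/measurable_cell_event.
Qed.

Lemma Rintegral_scaled_mean_cvg (eta_ : nat -> T -> R) (eta : T -> R) :
  (forall l, measurable_fun setT (eta_ l)) -> measurable_fun setT eta ->
  {ae Pr, forall w, eta_ l w @[l --> \oo] --> eta w} ->
  \int[Pr]_w scaled_mean (quantize l (eta_ l w)) @[l --> \oo]
    --> \int[Pr]_w scaled_mean (eta w).
Proof.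
move=> me_ me he; have [M hM] := bounded_fun_norm_le.
apply: (@bRintegral_cvg _ _ _ _ _ _ M).
- by move=> l; exact: bmeas_mfun (bmeas_scaled_mean_quantize l (me_ l)).
- apply: (@measurable_fun_cvg _ _ _ _ (fun l w => scaled_mean (quantize l (eta w)))).
    by move=> l; exact: bmeas_mfun (bmeas_scaled_mean_quantize l me).
  by move=> w _; apply: scaled_mean_cvg; apply: quantize_cvg; exact: cvg_cst.
- move=> l w; apply: bRintegral_bound => //.
  by apply: measurable_continuous_row => // i; exact: measurable_funM.
- apply: filterS he => w hw; apply: scaled_mean_cvg; exact: quantize_cvg.
Qed.

Variables (eta : T -> R).
Hypothesis meta : measurable_fun setT eta.

(** When [zs] is independent of [eta], the mean of [f (eta * zs)] can be computed
    by integrating over [zs] first; it suffices to know this on the cells. *)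
Lemma Rintegral_f_independent :
  (forall l k (g : 'rV[R]_m -> R), continuous g -> bounded_fun g ->
    \int[Pr]_w (\1_(cell_event l k eta) w * g (\row_i zs i w))
    = fine (Pr (cell_event l k eta)) * \int[Pr]_w g (\row_i zs i w)) ->
  \int[Pr]_w f (\row_i (eta w * zs i w)) = \int[Pr]_w scaled_mean (eta w).
Proof.
move=> hind; have [M hM] := bounded_fun_norm_le.
have h1 : \int[Pr]_w f (\row_i (quantize l (eta w) * zs i w)) @[l --> \oo]
    --> \int[Pr]_w f (\row_i (eta w * zs i w)).
  apply: (@bRintegral_cvg _ _ _ _ _ _ M) => //.
  - move=> l; apply: measurable_continuous_row => // i.
    by apply: measurable_funM => //; exact: measurableT_comp (measurable_quantize l) meta.
  - by apply: measurable_continuous_row => // i; exact: measurable_funM.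
  - apply: aeW => w; apply: continuous_row_cvg => // i.
    apply: cvgM; last exact: cvg_cst.
    by apply: quantize_cvg; exact: cvg_cst.
have h2 : \int[Pr]_w scaled_mean (quantize l (eta w)) @[l --> \oo]
    --> \int[Pr]_w scaled_mean (eta w).
  by apply: Rintegral_scaled_mean_cvg => //; apply: aeW => w; exact: cvg_cst.
rewrite -(cvg_lim (@Rhausdorff R) h1) -(cvg_lim (@Rhausdorff R) h2).
congr (limn _); apply/funext => l.
rewrite Rintegral_scaled_mean_quantize// Rintegral_f_quantize//.
apply: eq_bigr => k _; rewrite hind//.
  exact: continuous_scaled_fun.
exact: bounded_scaled_fun.
Qed.


(** If the vectors [Y n] are asymptotically independent, with limit law that of
    [zs], of the events decided by each of the variables [eta_ l], which
    converge to [eta], and if [zs] is independent of [eta], then every sequence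
    asymptotic to [eta * Y n] converges in distribution to [eta * zs]. *)
Lemma mixing_limit (Y H : nat -> 'I_m -> T -> R) (eta_ : nat -> T -> R) :
  (forall n i, measurable_fun setT (Y n i)) ->
  (forall n i, measurable_fun setT (H n i)) ->
  (forall l, measurable_fun setT (eta_ l)) ->
  tight (fun n => l1norm (Y n)) ->
  {ae Pr, forall w, eta_ l w @[l --> \oo] --> eta w} ->
  {ae Pr, forall w, forall i, H n i w - eta w * Y n i w @[n --> \oo] --> 0} ->
  (forall l k (g : 'rV[R]_m -> R), continuous g -> bounded_fun g ->
    \int[Pr]_w (\1_(cell_event l k (eta_ l)) w * g (\row_i Y n i w)) @[n --> \oo] -->
      fine (Pr (cell_event l k (eta_ l))) * \int[Pr]_w g (\row_i zs i w)) ->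
  (forall l k (g : 'rV[R]_m -> R), continuous g -> bounded_fun g ->
    \int[Pr]_w (\1_(cell_event l k eta) w * g (\row_i zs i w))
    = fine (Pr (cell_event l k eta)) * \int[Pr]_w g (\row_i zs i w)) ->
  \int[Pr]_w f (\row_i H n i w) @[n --> \oo]
    --> \int[Pr]_w f (\row_i (eta w * zs i w)).
Proof.
move=> mY mH meta_ tY heta hH hmix hind.
rewrite Rintegral_f_independent//.
pose K n i w := eta w * Y n i w.
have mK n i : measurable_fun setT (K n i) by exact: measurable_funM.
have tK : tight (fun n => l1norm (K n)) by exact: tight_scale.
have mq l : measurable_fun setT (fun w => quantize l (eta_ l w)).
  exact: measurableT_comp (measurable_quantize l) (meta_ l).
apply/cvgrPdist_le => e e0.
have e4 : 0 < e / 4 by rewrite divr_gt0.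
have [dl dl0 hdl] := tight_approx cf bf mK tK e4.
have dl20 : 0 < dl / 2 by rewrite divr_gt0.
(* Tightness makes the choice of the level [l] below uniform in [n]. *)
have [b hb] := tY _ dl20.
pose b1 := `|b| + 1.
have b10 : 0 < b1 by rewrite ltr_wpDl.
have hq : \forall l \near \oo,
    fine (Pr [set w | dl / b1 <= `|quantize l (eta_ l w) - eta w|]) <= dl / 2.
  have h : fine (Pr [set w | dl / b1 <= `|quantize l (eta_ l w) - eta w|])
      @[l --> \oo] --> (0 : R).
    apply: ae_cvg0_in_probability; last by rewrite divr_gt0.
      by move=> l; apply: measurableT_comp => //; exact: measurable_funB.
    apply: filterS heta => w hw; apply/cvgr0Pnorm_lt => r r0.
    move/quantize_cvg: hw => /subr_cvg0/cvgr0Pnorm_lt/(_ _ r0).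
    by apply: filterS => l; rewrite normr_id.
  move/cvgr0Pnorm_lt: h => /(_ _ dl20); apply: filterS => l hl.
  by rewrite ltW// (le_lt_trans _ hl)// ler_norm.
have hpsi := Rintegral_scaled_mean_cvg meta_ meta heta.
have [l [hl1 hl2]] : exists l,
    (forall n, `|\int[Pr]_w f (\row_i (quantize l (eta_ l w) * Y n i w))
      - \int[Pr]_w f (\row_i K n i w)| <= e / 4) /\
    `|\int[Pr]_w scaled_mean (quantize l (eta_ l w))
        - \int[Pr]_w scaled_mean (eta w)| <= e / 4.
  have : \forall l \near \oo, (forall n,
      `|\int[Pr]_w f (\row_i (quantize l (eta_ l w) * Y n i w))
      - \int[Pr]_w f (\row_i K n i w)| <= e / 4) /\
    `|\int[Pr]_w scaled_mean (quantize l (eta_ l w))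
        - \int[Pr]_w scaled_mean (eta w)| <= e / 4.
    have h2 : \forall l \near \oo,
      `|\int[Pr]_w scaled_mean (quantize l (eta_ l w))
        - \int[Pr]_w scaled_mean (eta w)| <= e / 4.
      move/cvgrPdist_le: hpsi => /(_ _ e4); apply: filterS => l.
      by rewrite distrC.
    apply: filterS2 hq h2 => l hl h2; split => // n.
    apply: (hdl n (fun i w => quantize l (eta_ l w) * Y n i w)).
      by move=> i; exact: measurable_funM.
    have mA1 : measurable [set w | b < l1norm (Y n) w].
      by apply: measurable_gt_set; exact: measurable_l1norm.
    have mA2 : measurable [set w | dl / b1 <= `|quantize l (eta_ l w) - eta w|].
      apply: measurable_ge_set; apply: measurableT_comp => //.
      exact: measurable_funB.
    apply: (@le_trans _ _ (dl / 2 + dl / 2)); last by rewrite -splitr.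
    apply: le_trans (lerD (hb n) hl).
    apply: le_trans (fine_Pr_setU Pr mA1 mA2).
    apply: fine_Pr_le.
    - apply: measurable_ge_set; apply: measurable_l1norm => i.
      by apply: measurable_funB; exact: measurable_funM.
    - exact: measurableU.
    move=> w /=; apply: contraPP => /not_orP[/negP + /negP].
    rewrite -leNgt -ltNge ltr_pdivlMr// => h3 h4.
    apply/negP; rewrite -ltNge; apply: le_lt_trans h4.
    rewrite /l1norm /K; under eq_bigr do rewrite -mulrBl normrM.
    rewrite -mulr_sumr ler_wpM2l// (le_trans h3)// /b1.
    by rewrite (le_trans (ler_norm _))// lerDl.
  by move=> [l _ hl]; exists l; exact: (hl l (leqnn l)).
have hHK : \forall n \near \oo, `|\int[Pr]_w f (\row_i H n i w)
     - \int[Pr]_w f (\row_i K n i w)| <= e / 4.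
  have h : fine (Pr [set w | dl <= l1norm (fun i w => H n i w - K n i w) w])
      @[n --> \oo] --> (0 : R).
    apply: ae_cvg0_in_probability => //.
      move=> n; apply: measurable_l1norm => i; exact: measurable_funB.
    apply: filterS hH => w hw; rewrite /l1norm.
    rewrite -[X in _ --> X](_ : \sum_(i < m) (0 : R) = 0); last by rewrite big1.
    apply: cvg_sumr => i; rewrite -[X in _ --> X](@normr0 _ R).
    by apply: cvg_norm; exact: hw.
  move/cvgr0Pnorm_lt: h => /(_ _ dl0); apply: filterS => n hn.
  apply: hdl => //; rewrite ltW// (le_lt_trans _ hn)// ler_norm//.
have hlim : \int[Pr]_w f (\row_i (quantize l (eta_ l w) * Y n i w)) @[n --> \oo]
    --> \int[Pr]_w scaled_mean (quantize l (eta_ l w)).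
  rewrite Rintegral_scaled_mean_quantize//.
  under eq_fun do rewrite Rintegral_f_quantize//.
  apply: cvg_sumr => k; apply: hmix; first exact: continuous_scaled_fun.
  exact: bounded_scaled_fun.
move/cvgrPdist_le: hlim => /(_ _ e4) hlim.
apply: filterS2 hHK hlim => n h1 h2; have h3 := hl1 n.
move: h1 h2 h3 hl2; rewrite !ler_distl =>
  /andP[? ?] /andP[? ?] /andP[? ?] /andP[? ?].
by apply/andP; split; lra.
Qed.

End MixingLimit.

(** * Measurability of limits, equality in law and bounds in mean *)

Lemma cvgn_cauchy (R : realType) (v : nat -> R) :
  cvgn v <-> forall k : nat, exists N : nat, forall n : nat,
    `|v (N + n)%N - v N| <= k.+1%:R^-1.
Proof.
split => [cv k|h].
  have /cvgrPdist_le/(_ (k.+1%:R^-1 / 2)) := cv.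
  rewrite divr_gt0// => /(_ isT)[N _ hN].
  exists N => n; rewrite -(subrK (limn v) (v (N + n)%N)) -addrA.
  rewrite (le_trans (ler_normD _ _))// (splitr k.+1%:R^-1) lerD//.
    by rewrite distrC hN//= leq_addr.
  by rewrite hN/=.
apply/cauchy_cvgP/cauchy_exP => e e0.
have [k hk] : exists k : nat, k.+1%:R^-1 < e.
  by have [k _ hk] := near_infty_natSinv_lt (PosNum e0); exists k; apply: hk => /=.
have [N hN] := h k; exists (v N); exists N => // n /= Nn.
rewrite -ball_normE /ball_ /= distrC (le_lt_trans _ hk)//.
by have := hN (n - N)%N; rewrite subnKC.
Qed.

(** The limit of measurable functions is measurable without any assumption of
    convergence: the set of convergence is measurable, and [limn] takes a fixed
    default value outside it. *)
Lemma measurable_limn (d : measure_display) (T : measurableType d)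
    (R : realType) (h : nat -> T -> R) :
  (forall n, measurable_fun setT (h n)) ->
  measurable_fun setT (fun w => limn (fun n => h n w)).
Proof.
move=> mh; pose C := [set w | cvgn (fun n => h n w)].
have mC : measurable C.
  rewrite [X in measurable X](_ : _ = \bigcap_k \bigcup_N \bigcap_n
      [set w | `|h (N + n)%N w - h N w| <= k.+1%:R^-1]).
    apply: bigcapT_measurable => k; apply: bigcupT_measurable => N.
    apply: bigcapT_measurable => n.
    rewrite [X in measurable X](_ : _ =
      ~` [set w | k.+1%:R^-1 < `|h (N + n)%N w - h N w|]).
      apply: measurableC; apply: measurable_gt_set.
      by apply: measurableT_comp => //; exact: measurable_funB.
    apply/seteqP; split => w /=; first by rewrite leNgt => /negP.
    by move=> /negP; rewrite leNgt.
  apply/seteqP; split => [w /cvgn_cauchy hw k _|w hw].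
    by have [N hN] := hw k; exists N => // n _; exact: hN.
  by apply/cvgn_cauchy => k; have [N _ hN] := hw k I; exists N => n; apply: (hN n I).
apply: (@measurable_fun_cvg d T R setT
  (fun n w => \1_C w * h n w + (1 - \1_C w) * (point : R))).
  move=> n; have mi := @measurable_indic _ _ R setT C mC.
  apply: measurable_funD; first exact: measurable_funM.
  by apply: measurable_funM => //; exact: measurable_funB.
move=> w _ /=; rewrite indicE; case: (boolP (w \in C)) => [|/negP wC].
  rewrite inE /C /= => cw; rewrite subrr mul0r.
  by under eq_fun do rewrite mul1r addr0; exact: cw.
rewrite subr0 mul1r; under eq_fun do rewrite mul0r add0r.
rewrite dvgP; first exact: cvg_cst.
by move=> cw; apply: wC; rewrite inE.
Qed.

Section SameLaw.
Context (d : measure_display) (T : measurableType d) (R : realType)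
        (Pr : probability T R) (n : nat).
Variables (Y W : 'I_n -> T -> R).
Hypotheses (mY : forall i, measurable_fun setT (Y i))
  (mW : forall i, measurable_fun setT (W i)) (YW : same_law Pr Y W).

Lemma measurable_mktuple (V : 'I_n -> T -> R) :
  (forall i, measurable_fun setT (V i)) ->
  measurable_fun setT (fun w => [tuple V i w | i < n]).
Proof.
move=> mV; apply/(measurable_fun_tnthP (fun w => [tuple V i w | i < n])) => i.
by rewrite (_ : _ \o _ = V i)//; apply/funext => w /=; exact: tnth_mktuple.
Qed.

Lemma same_law_ge0_integral (g : n.-tuple R -> \bar R) :
  measurable_fun setT g -> (forall t, (0 <= g t)%E) ->
  (\int[Pr]_w g [tuple Y i w | i < n] = \int[Pr]_w g [tuple W i w | i < n])%E.
Proof.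
move=> mg g0.
have h (V : 'I_n -> T -> R) (mV : forall i, measurable_fun setT (V i)) :=
  @ge0_integral_pushforward _ _ _ _ R _ (measurable_mktuple mV) Pr setT g
    measurableT mg (fun t _ => g0 t).
have := h W mW; have := h Y mY; rewrite !preimage_setT /comp => <- <-.
apply: eq_measure_integral => [||? ? A mA _]; last exact: YW.
  exact: measurable_mktuple.
exact: measurable_mktuple.
Qed.

Lemma same_law_Rintegral (g : n.-tuple R -> R) : bmeas g ->
  \int[Pr]_w g [tuple Y i w | i < n] = \int[Pr]_w g [tuple W i w | i < n].
Proof.
move=> bg; have [mg [M hM]] := bg.
have hV (V : 'I_n -> T -> R) : (forall i, measurable_fun setT (V i)) ->
    bmeas (fun w => g [tuple V i w | i < n]).
  move=> mV; split; last by exists M.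
  exact: measurableT_comp mg (measurable_mktuple mV).
have h (V : 'I_n -> T -> R) (mV : forall i, measurable_fun setT (V i)) :
    (\int[Pr]_w (g [tuple V i w | i < n] + M)%:E
     = (\int[Pr]_w g [tuple V i w | i < n] + M)%:E)%E.
  have bM := bmeas_cst T M.
  have <- : \int[Pr]_w (g [tuple V i w | i < n] + M)
      = \int[Pr]_w g [tuple V i w | i < n] + M.
    by rewrite bRintegralD ?bRintegral_cst//; exact: hV.
  rewrite -expectation_bmeas; last exact: bmeasD (hV _ mV) bM.
  by rewrite unlock.
apply: (addIr M); apply: EFin_inj; rewrite -h// -h//.
apply: (@same_law_ge0_integral (fun t => (g t + M)%:E)).
  by apply/measurable_EFinP; apply: measurable_funD.
move=> t; rewrite lee_fin -lerBlDr sub0r.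
by have := hM t; rewrite ler_norml => /andP[].
Qed.

End SameLaw.

Section L1Bounds.
Context (d : measure_display) (T : measurableType d) (R : realType)
        (Pr : probability T R).

(** [v] is measurable and its absolute value has mean at most [C]. *)
Definition mean_le (v : T -> R) (C : R) : Prop :=
  measurable_fun setT v /\ (\int[Pr]_w `|v w|%:E <= C%:E)%E.

Let mnorm (v : T -> R) : measurable_fun setT v ->
  measurable_fun setT (fun w => `|v w|%:E).
Proof. by move=> mv; apply/measurable_EFinP; exact: measurableT_comp. Qed.

Lemma mean_leD v1 v2 C1 C2 : mean_le v1 C1 -> mean_le v2 C2 ->
  mean_le (fun w => v1 w + v2 w) (C1 + C2).
Proof.
move=> [m1 h1] [m2 h2]; split; first exact: measurable_funD.
apply: (@le_trans _ _ (\int[Pr]_w (`|v1 w|%:E + `|v2 w|%:E))%E); last first.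
  rewrite ge0_integralD//; [by rewrite EFinD leeD|exact: mnorm|exact: mnorm].
apply: ge0_le_integral => //.
- by apply: mnorm; exact: measurable_funD.
- by apply: emeasurable_funD; exact: mnorm.
- by move=> w _; rewrite -EFinD lee_fin ler_normD.
Qed.

Lemma mean_leZ c v C : mean_le v C -> mean_le (fun w => c * v w) (`|c| * C).
Proof.
move=> [mv hv]; split; first exact: measurable_funM.
under eq_integral do rewrite normrM EFinM.
by rewrite ge0_integralZl_EFin//; [rewrite EFinM lee_wpmul2l|exact: mnorm].
Qed.

Lemma mean_le_le v C D : C <= D -> mean_le v C -> mean_le v D.
Proof. by move=> CD [mv hv]; split => //; rewrite (le_trans hv)// lee_fin. Qed.

Lemma mean_le0 : mean_le (fun _ => 0) 0.
Proof.
split; first exact: measurable_cst.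
by rewrite integral0_eq// => w _; rewrite normr0.
Qed.

Lemma mean_le_geo_sum (phi C : R) (e : nat -> T -> R) : 1 < `|phi| ->
  (forall j, mean_le (e j) C) ->
  forall n, mean_le (fun w => geo_sum phi (fun j => e j w) n) (C / (`|phi| - 1)).
Proof.
move=> phi1 he.
have phi0 : 0 < `|phi| by rewrite (lt_trans _ phi1).
have d0 : 0 < `|phi| - 1 by rewrite subr_gt0.
have C0 : 0 <= C.
  rewrite -lee_fin (le_trans _ (he 0%N).2)//; exact: integral_ge0.
elim=> [|n IH].
  rewrite (_ : (fun w => _) = fun=> 0).
    by apply: (mean_le_le _ mean_le0); rewrite divr_ge0// ltW.
  by apply/funext => w; rewrite /geo_sum big_geq.
have := mean_leZ phi^-1 (mean_leD IH (he n)).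
rewrite (_ : `|phi^-1| * _ = C / (`|phi| - 1)).
  by congr mean_le; apply/funext => w; rewrite geo_sumS.
by rewrite normfV; field; rewrite gt_eqF// gt_eqF.
Qed.

Lemma mean_le_l1norm (m : nat) (Y : 'I_m -> T -> R) (C : 'I_m -> R) :
  (forall i, mean_le (Y i) (C i)) -> mean_le (l1norm Y) (\sum_(i < m) C i).
Proof.
move=> hY.
have h (s : seq 'I_m) :
    mean_le (fun w => \sum_(i <- s) `|Y i w|) (\sum_(i <- s) C i).
  elim: s => [|i s IH].
    rewrite big_nil (_ : (fun w => _) = fun=> 0); first exact: mean_le0.
    by apply/funext => w; rewrite big_nil.
  rewrite big_cons (_ : (fun w => _) = (fun w => `|Y i w| + \sum_(i <- s) `|Y i w|)).
    apply: mean_leD IH; have [mY' hY'] := hY i.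
    split; first exact: measurableT_comp.
    by under eq_integral do rewrite normr_id.
  by apply/funext => w; rewrite big_cons.
exact: h.
Qed.

(** Markov inequality. *)
Lemma mean_le_tight (S : nat -> T -> R) (C : R) :
  (forall n, mean_le (S n) C) -> tight Pr S.
Proof.
move=> hS e e0.
have C0 : 0 <= C.
  rewrite -lee_fin (le_trans _ (hS 0%N).2)//; exact: integral_ge0.
pose b := (C + 1) / e.
have b0 : 0 < b by rewrite divr_gt0// ltr_wpDl.
exists b => n; have [mS h] := hS n.
have mA : measurable [set w | b < S n w] by exact: measurable_gt_set.
have : (\int[Pr]_w (b * \1_[set w | b < S n w] w)%:E <= C%:E)%E.
  apply: le_trans h; apply: ge0_le_integral => //.
  - by move=> w _; rewrite lee_fin mulr_ge0// ltW.
  - by apply/measurable_EFinP; apply: measurable_funM => //; exact: measurable_indic.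
  - exact: mnorm.
  - move=> w _; rewrite lee_fin indicE; case: (boolP (w \in _)) => [|_].
      by rewrite inE mulr1 => /= /ltW bS; rewrite (le_trans bS)// ler_norm.
    by rewrite mulr0.
have bi := bmeasM (bmeas_cst _ b) (@bmeas_indic _ _ R _ mA).
have -> : (\int[Pr]_w (b * \1_[set w | b < S n w] w)%:E
   = (b * fine (Pr [set w | b < S n w]))%:E)%E.
  rewrite -bRintegral_indic// -bRintegralZ; last exact: bmeas_indic.
  by rewrite -expectation_bmeas// unlock.
rewrite lee_fin mulrC -ler_pdivlMr// => /le_trans; apply.
by rewrite /b invf_div mulrCA ler_piMr ?(ltW e0)// ler_pdivrMr ?mul1r ?lerDl ?ltr_wpDl.
Qed.

(** Random variables bounded in mean grow slower than any geometric sequence,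
    almost surely. *)
Lemma mean_le_geoO (rho C : R) (v : nat -> T -> R) : 1 < rho ->
  (forall j, mean_le (v j) C) -> {ae Pr, forall w, geoO rho (fun j => v j w)}.
Proof.
move=> rho1 hv; have rho0 : 0 < rho by rewrite (lt_trans _ rho1).
have q0 : 0 < 1 - rho^-1 by rewrite subr_gt0 invf_lt1.
have C0 : 0 <= C.
  rewrite -lee_fin (le_trans _ (hv 0%N).2)//; exact: integral_ge0.
(* The series of the [rho^-j * |v_j|] has finite mean, so it converges almost
   surely, and its sum bounds each of its terms. *)
pose F j w := (`|rho^-1 ^+ j * v j w|)%:E.
have hF j : (\int[Pr]_w F j w <= (rho^-1 ^+ j * C)%:E)%E.
  have [_] := mean_leZ (rho^-1 ^+ j) (hv j).
  by rewrite ger0_norm// exprn_ge0// invr_ge0 ltW.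
have mF j : measurable_fun setT (F j).
  by apply: mnorm; apply: measurable_funM => //; case: (hv j).
have F0 j w : (0 <= F j w)%E by rewrite lee_fin.
have hsum n : \sum_(0 <= j < n) rho^-1 ^+ j <= (1 - rho^-1)^-1.
  have -> : \sum_(0 <= j < n) rho^-1 ^+ j = (1 - rho^-1 ^+ n) / (1 - rho^-1).
    elim: n => [|n IH]; first by rewrite big_geq// expr0 subrr mul0r.
    rewrite big_nat_recr//= IH exprS; move: q0; set q := rho^-1 => q0.
    by field; rewrite gt_eqF.
  rewrite ler_pdivrMr// mulVf ?gt_eqF// gerBl exprn_ge0// invr_ge0 ltW//.
have hlim : (\int[Pr]_w (\sum_(j <oo) F j w) <= (C / (1 - rho^-1))%:E)%E.
  rewrite integral_nneseries//.
  apply: lime_le; first by apply: is_cvg_nneseries => j _ _; exact: integral_ge0.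
  apply: nearW => n; apply: (@le_trans _ _ (\sum_(0 <= j < n) (rho^-1 ^+ j * C)%:E)%E).
    by apply: lee_sum => j _; exact: hF.
  rewrite sumEFin lee_fin -mulr_suml mulrC ler_wpM2l//.
have hint : Pr.-integrable setT (fun w => (\sum_(j <oo) F j w)%E).
  apply/integrableP; split.
    by apply: ge0_emeasurable_sum.
  under eq_integral do rewrite gee0_abs ?nneseries_ge0//.
  by rewrite (le_lt_trans hlim)// ltry.
apply: filterS (integrable_ae measurableT hint) => w /(_ I) hfin.
exists (fine (\sum_(j <oo) F j w)%E) => j.
have : (F j w <= (fine (\sum_(j <oo) F j w)%E)%:E)%E.
  rewrite fineK//; apply: le_trans (nneseries_lim_ge j.+1 _) => //.
  by rewrite big_nat_recr//= leeDr// sume_ge0.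
rewrite lee_fin normrM exprVn normfV (ger0_norm (exprn_ge0 j (ltW rho0))).
by rewrite mulrC ler_pdivrMr ?exprn_gt0.
Qed.

End L1Bounds.

(** * Sigma-algebras of families and moments of the noise *)

(** The inverse, extended by [0] at [0], is the limit of continuous functions. *)
Lemma measurable_inv (R : realType) : measurable_fun setT (fun x : R => x^-1).
Proof.
apply: (@measurable_fun_cvg _ _ R setT
  (fun n (x : R) => x / (x ^+ 2 + n.+1%:R^-1))) => [n|x _].
  apply: measurable_funM => //; apply: continuous_measurable_fun => x.
  apply: cvgV.
    by rewrite gt_eqF// ltr_wpDl// ?sqr_ge0.
  by apply: cvgD; [exact: exprn_continuous|exact: cvg_cst].
have [->|x0] := eqVneq x 0.
  by under eq_fun do rewrite mul0r; rewrite invr0; exact: cvg_cst.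
have -> : x^-1 = x / (x ^+ 2 + 0) by rewrite addr0; field.
apply: cvgM; first exact: cvg_cst.
apply: cvgV; first by rewrite addr0 sqrf_eq0.
by apply: cvgD; [exact: cvg_cst|exact: cvg_harmonic].
Qed.

Section SigmaRV.
Context (d : measure_display) (T : measurableType d) (R : realType) (I : Type)
        (D : set I) (Y : I -> T -> R).

(** The generators of [sigma_rv D Y]. Measurability with respect to [sigma_rv D Y]
    is measurability on the type [g_sigma_algebraType rv_gen]. *)
Definition rv_gen : set (set T) :=
  \bigcup_(i in D) preimage_set_system setT (Y i) measurable.

Lemma sigma_rv_measurable (g : T -> R) (B : set nat) (l : nat) :
  measurable_fun (setT : set (g_sigma_algebraType rv_gen))
    (g : g_sigma_algebraType rv_gen -> R) ->
  sigma_rv D Y [set w | B (cell l (g w))].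
Proof.
move=> mg; exact: (@measurable_cell_set _ (g_sigma_algebraType rv_gen) R g l B mg).
Qed.

Lemma measurable_rv_gen (i : I) : D i ->
  measurable_fun (setT : set (g_sigma_algebraType rv_gen))
    (Y i : g_sigma_algebraType rv_gen -> R).
Proof.
move=> Di _ B mB; apply: sub_sigma_algebra.
by exists i => //; exists B.
Qed.

End SigmaRV.

Section MeanNoise.
Context (d : measure_display) (T : measurableType d) (R : realType)
        (Pr : probability T R).

Lemma Lfun2_mean_le (v : T -> R) : v \in Lfun Pr 2%:E -> exists C, mean_le Pr v C.
Proof.
move=> hv; have /Lfun1_integrable/integrableP[mv iv] : v \in Lfun Pr 1.
  by apply: Lfun_subset12 hv; rewrite fin_num_measure.
exists (fine (\int[Pr]_w `|v w|%:E)%E); split; first exact/measurable_EFinP.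
rewrite fineK// ge0_fin_numE//; exact: integral_ge0.
Qed.

Lemma same_law_mean_le (n : nat) (Y W : 'I_n -> T -> R) (i : 'I_n) (C : R) :
  (forall i, measurable_fun setT (Y i)) ->
  (forall i, measurable_fun setT (W i)) -> same_law Pr Y W ->
  mean_le Pr (W i) C -> mean_le Pr (Y i) C.
Proof.
move=> mY mW YW [_ hW]; split => //; apply: le_trans hW.
have mg : measurable_fun setT (fun t : n.-tuple R => `|tnth t i|%:E).
  apply/measurable_EFinP; apply: measurableT_comp => //.
  exact: measurable_tnth.
have h := same_law_ge0_integral mY mW YW mg (fun t => normr_ge0 _).
rewrite le_eqVlt; apply/orP; left; apply/eqP.
have hV (V : 'I_n -> T -> R) : (\int[Pr]_w `|tnth [tuple V j w | j < n] i|%:E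
    = \int[Pr]_w `|V i w|%:E)%E.
  by apply: eq_integral => w _; rewrite tnth_mktuple.
by rewrite -(hV Y) -(hV W).
Qed.

(** Periodicity in law makes the bound in mean uniform in time. *)
Lemma periodic_mean_le (p : nat) (u : int -> T -> R) :
  (0 < p)%N -> (forall k, measurable_fun setT (u k)) ->
  (forall k, u k \in Lfun Pr 2%:E) -> periodically_distributed Pr p u ->
  exists C, forall k : nat, mean_le Pr (u k%:Z) C.
Proof.
move=> p0 mu u2 up.
have /choice[C hC] : forall s : nat, exists C, mean_le Pr (u s%:Z) C.
  by move=> s; exact: Lfun2_mean_le.
have C0 s : 0 <= C s.
  rewrite -lee_fin (le_trans _ (hC s).2)//; exact: integral_ge0.
exists (\sum_(0 <= s < p) C s) => k.
rewrite (divn_eq k p); elim: (k %/ p)%N => [|j IH].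
  rewrite mul0n add0n; apply: mean_le_le (hC _).
  rewrite (bigD1_seq (k %% p)%N) ?iota_uniq//=.
    by rewrite lerDl sumr_ge0.
  by rewrite mem_index_iota ltn_pmod.
have := @same_law_mean_le 1 _ _ ord0 (\sum_(0 <= s < p) C s) _ _
  (up (j * p + k %% p)%N%:Z 0%N).
rewrite /= !addr0 => h.
rewrite mulSn -addnA PoszD; apply: h => //.
Qed.

End MeanNoise.

(** * Time reversal and asymptotic independence *)

Lemma geo_sum_rev (R : realType) (phi : R) (e : nat -> R) (n : nat) :
  geo_sum phi e n = \sum_(1 <= q < n.+1) phi ^- q * e (n - q)%N.
Proof.
rewrite /geo_sum big_nat_rev big_add1 add0n; apply: eq_big_nat => j /andP[_ jn].
by rewrite subKn.
Qed.

Section Reversal.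
Context (d : measure_display) (T : measurableType d) (R : realType)
        (Pr : probability T R) (p : nat) (ph : R) (c : 'I_p -> R).
Variables (u : int -> T -> R) (ustar : nat -> T -> R).
Hypotheses (mu : forall k, measurable_fun setT (u k))
  (mus : forall k, measurable_fun setT (ustar k)) (p0 : (0 < p)%N)
  (phi1 : 1 < `|ph|).

(** The [k] most recent terms of the weighted sum of the noise after [n] periods,
    along the season [i.+1], scaled by [c i]; for [k = n] this is the whole sum. *)
Definition recent (n k : nat) (i : 'I_p) (w : T) : R :=
  c i * \sum_(1 <= q < k.+1) ph ^- q * u ((n - q) * p + i.+1)%N%:Z w.

(** The partial sums of the corresponding series in the reversed noise. *)
Definition reversed (k : nat) (i : 'I_p) (w : T) : R :=
  c i * \sum_(1 <= q < k.+1) ph ^- q * ustar (q * p - i.+1)%N w.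

(** The sum of that series, where it converges. *)
Definition reversed_limit (i : 'I_p) (w : T) : R :=
  c i * limn (fun n : nat => \sum_(1 <= q < n.+1) ph ^- q * ustar (q * p - i.+1)%N w).

Lemma measurable_sum_nat (v : nat -> T -> R) (a b : nat) :
  (forall k, measurable_fun setT (v k)) ->
  measurable_fun setT (fun w => \sum_(a <= q < b) v q w).
Proof. by move=> mv; apply: measurable_sum => q. Qed.

Lemma measurable_recent n k i : measurable_fun setT (recent n k i).
Proof.
apply: measurable_funM => //; apply: measurable_sum_nat => q.
exact: measurable_funM.
Qed.

Lemma measurable_reversed k i : measurable_fun setT (reversed k i).
Proof.
apply: measurable_funM => //; apply: measurable_sum_nat => q.
exact: measurable_funM.
Qed.

Lemma measurable_reversed_limit i : measurable_fun setT (reversed_limit i).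
Proof.
apply: measurable_funM => //; apply: measurable_limn => n.
by apply: measurable_sum_nat => q; exact: measurable_funM.
Qed.

(** The linear form on windows of length [N] that yields [reversed] on the window
    of the reversed noise, and [recent] on the window of the noise read
    backwards. *)
Definition reversal_form (N k : nat) (i : 'I_p) (t : N.-tuple R) : R :=
  c i * \sum_(1 <= q < k.+1) ph ^- q * nth 0 t (q * p - i.+1)%N.

Lemma measurable_reversal_form N k i : measurable_fun setT (@reversal_form N k i).
Proof.
apply: measurable_funM => //; apply: measurable_sum => q.
apply: measurable_funM => //.
have [h|h] := ltnP (q * p - i.+1)%N N.
  rewrite (_ : (fun t : N.-tuple R => _) = (fun t => tnth t (Ordinal h))).
    exact: measurable_tnth.
  by apply/funext => t; rewrite (tnth_nth 0).
rewrite (_ : (fun t : N.-tuple R => _) = cst 0) //.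
by apply/funext => t; rewrite nth_default// size_tuple.
Qed.

(** The index of the reversed noise that corresponds to the season [i.+1] of the
    [q]-th period counted from the end. *)
Lemma reversed_index (n q : nat) (i : 'I_p) : (1 <= q <= n)%N ->
  (q * p - i.+1 < n * p)%N /\
  (n * p - (q * p - i.+1) = (n - q) * p + i.+1)%N.
Proof.
move=> /andP[q1 qn].
have ip : (i.+1 <= q * p)%N by rewrite (leq_trans (ltn_ord i))// leq_pmull.
have qp : (q * p <= n * p)%N by rewrite leq_mul2r qn orbT.
split; first by rewrite ltn_subLR// (leq_ltn_trans qp)// addSn ltnS leq_addl.
by rewrite subnBA// mulnBl addnBAC.
Qed.

Lemma reversal_form_reversed n k i w : (k <= n)%N ->
  reversal_form k i [tuple ustar j w | j < n * p] = reversed k i w.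
Proof.
move=> kn; rewrite /reversal_form /reversed; congr (_ * _).
apply: eq_big_nat => q /andP[q1 qk].
have [h _] : (q * p - i.+1 < n * p)%N /\
  (n * p - (q * p - i.+1) = (n - q) * p + i.+1)%N.
  by apply: reversed_index; rewrite q1 (leq_trans _ kn).
by rewrite -[(q * p - i.+1)%N]/(nat_of_ord (Ordinal h)) -tnth_nth tnth_mktuple.
Qed.

Lemma reversal_form_recent n k i w : (k <= n)%N ->
  reversal_form k i [tuple u (n * p - j)%N%:Z w | j < n * p] = recent n k i w.
Proof.
move=> kn; rewrite /reversal_form /recent; congr (_ * _).
apply: eq_big_nat => q /andP[q1 qk].
have [h hE] : (q * p - i.+1 < n * p)%N /\
  (n * p - (q * p - i.+1) = (n - q) * p + i.+1)%N.
  by apply: reversed_index; rewrite q1 (leq_trans _ kn).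
rewrite -[(q * p - i.+1)%N]/(nat_of_ord (Ordinal h)) -tnth_nth tnth_mktuple.
by rewrite /= hE.
Qed.

Hypothesis urev : forall n : nat, (1 < n)%N ->
  same_law Pr (fun i : 'I_(n * p) => ustar i)
              (fun i : 'I_(n * p) => u (n * p - i)%N%:Z).

Variable h : 'rV[R]_p -> R.
Hypotheses (ch : continuous h) (bh : bounded_fun h).

Lemma Rintegral_recent n k : (1 < n)%N -> (k <= n)%N ->
  \int[Pr]_w h (\row_i recent n k i w) = \int[Pr]_w h (\row_i reversed k i w).
Proof.
move=> n1 kn.
have bg : bmeas (fun t : (n * p).-tuple R => h (\row_i reversal_form k i t)).
  by apply: bmeas_row => // i; exact: measurable_reversal_form.
have := same_law_Rintegral (fun i : 'I_(n * p) => mus i)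
  (fun i : 'I_(n * p) => mu (n * p - i)%N%:Z) (urev n1) bg.
move=> e; symmetry; transitivity
    (\int[Pr]_w h (\row_i reversal_form k i [tuple ustar j w | j < n * p])).
  apply: eq_Rintegral => w _; congr h; apply/rowP => i.
  by rewrite !mxE reversal_form_reversed.
rewrite e; apply: eq_Rintegral => w _; congr h; apply/rowP => i.
by rewrite !mxE reversal_form_recent.
Qed.

Lemma Rintegral_recent_diff n k : (1 < n)%N -> (k <= n)%N ->
  \int[Pr]_w `|h (\row_i recent n n i w) - h (\row_i recent n k i w)|
  = \int[Pr]_w `|h (\row_i reversed n i w) - h (\row_i reversed k i w)|.
Proof.
move=> n1 kn.
have bg : bmeas (fun t : (n * p).-tuple R =>
    `|h (\row_i reversal_form n i t) - h (\row_i reversal_form k i t)|).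
  by apply: bmeas_norm; apply: bmeasB;
    apply: bmeas_row => // i; exact: measurable_reversal_form.
have := same_law_Rintegral (fun i : 'I_(n * p) => mus i)
  (fun i : 'I_(n * p) => mu (n * p - i)%N%:Z) (urev n1) bg.
move=> e; symmetry; transitivity
    (\int[Pr]_w (fun t : (n * p).-tuple R =>
      `|h (\row_i reversal_form n i t) - h (\row_i reversal_form k i t)|)
      [tuple ustar j w | j < n * p]).
  apply: eq_Rintegral => w _; congr (`|h _ - h _|); apply/rowP => i;
  by rewrite !mxE reversal_form_reversed.
rewrite e; apply: eq_Rintegral => w _; congr (`|h _ - h _|); apply/rowP => i;
by rewrite !mxE reversal_form_recent.
Qed.

Variable C : R.
Hypothesis usC : forall k, mean_le Pr (ustar k) C.

Lemma reversed_cvg : {ae Pr, forall w, forall i,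
  reversed k i w @[k --> \oo] --> reversed_limit i w}.
Proof.
pose rho := Num.sqrt `|ph|.
have rho1 : 1 < rho by rewrite -[ltLHS](@sqrtr1 R) ltr_sqrt// (lt_trans _ phi1).
have rho0 : 0 < rho by rewrite (lt_trans _ rho1).
have rhophi : rho < `|ph|.
  by rewrite -[ltRHS](@sqr_sqrtr R `|ph|)// -/rho ltr_eXnr.
have ph0 : 0 < `|ph| by rewrite (lt_trans _ phi1).
have hi (i : nat) : {ae Pr, forall w, geoO rho (fun j => ustar (j * p - i.+1)%N w)}.
  exact: (mean_le_geoO rho1 (fun j => usC (j * p - i.+1)%N)).
apply: filterS (ae_foralln hi) => w hw i.
apply: cvgM; first exact: cvg_cst.
have [K K0 hK] := geoO_ge0 (hw i).
pose x q := ph ^- q * ustar (q * p - i.+1)%N w.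
suff : cvgn (fun n => \sum_(1 <= q < n.+1) x q) by [].
have cx : cvgn (series x).
  apply: normed_cvg.
  apply: (@series_le_cvg _ _ (geometric K (rho / `|ph|))) => [q|q|q|].
  - exact: normr_ge0.
  - by rewrite /geometric /= mulr_ge0// exprn_ge0// divr_ge0// ltW.
  - rewrite /geometric /x /= normrM normfV normrX expr_div_n mulrA mulrC.
    by rewrite ler_pM2r ?invr_gt0 ?exprn_gt0.
  - apply: is_cvg_geometric_series.
    by rewrite ger0_norm ?divr_ge0 ?(ltW rho0)// ltr_pdivrMr// mul1r.
have -> : (fun n => \sum_(1 <= q < n.+1) x q)
    = (fun n => series x n.+1 - x 0%N).
  apply/funext => n.
  by rewrite big_add1 /series /= big_nat_recl//= addrAC subrr add0r.
apply/cvg_ex; exists (limn (series x) - x 0%N).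
by apply: cvgB; [rewrite (cvg_shiftS (series x))|exact: cvg_cst].
Qed.

Lemma reversed_L1_cvg :
  \int[Pr]_w `|h (\row_i reversed k i w) - h (\row_i reversed_limit i w)|
    @[k --> \oo] --> (0 : R).
Proof.
rewrite -[X in _ --> X](bRintegral_cst Pr 0).
have [M hM] := bounded_fun_norm_le bh.
apply: (@bRintegral_cvg _ _ _ _ _ _ (2 * M)).
- move=> k; apply: bmeas_mfun; apply: bmeas_norm.
  apply: bmeasB; apply: bmeas_row => // i; first exact: measurable_reversed.
  exact: measurable_reversed_limit.
- exact: measurable_cst.
- move=> k w; rewrite normr_id (le_trans (ler_normB _ _))//.
  by rewrite mulr2n mulrDl mul1r lerD.
- apply: filterS reversed_cvg => w hw.
  rewrite -[X in _ --> X](@normr0 _ R); apply: cvg_norm.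
  apply/subr_cvg0; exact: continuous_row_cvg.
Qed.

Variables (X0 : T -> R).
Hypothesis mX0 : measurable_fun setT X0.
Hypothesis mixing : mixing_coef Pr X0 u n @[n --> \oo] --> 0.

Lemma sigma_rv_sub (I : Type) (D : set I) (Y : I -> T -> R) (A : set T) :
  (forall i, measurable_fun setT (Y i)) -> sigma_rv D Y A -> measurable A.
Proof.
move=> mY; rewrite /sigma_rv => hA; apply: hA; split.
  exact: sigma_algebra_measurable.
by move=> _ [i _ [B mB <-]]; exact: mY.
Qed.

Lemma measurable_adjoin o : measurable_fun setT (adjoin X0 u o).
Proof. by case: o. Qed.

(** The supremum that defines the mixing coefficient is that of a bounded set. *)
Lemma mixing_coef_ge (N k : nat) (A B : set T) :
  past X0 u k A -> future u (k + N) B ->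
  `|fine (Pr (A `&` B)) - fine (Pr A) * fine (Pr B)| <= mixing_coef Pr X0 u N.
Proof.
move=> hA hB; apply: ub_le_sup; last by exists k, A, B.
exists 1 => _ [k' [A' [B' [hA' hB' ->]]]].
have mA : measurable A' by apply: sigma_rv_sub hA'; exact: measurable_adjoin.
have mB : measurable B' by apply: sigma_rv_sub hB'; exact: mu.
have mAB : measurable (A' `&` B') by exact: measurableI.
have := fine_Pr_le1 Pr mA; have := fine_Pr_le1 Pr mB.
have := fine_Pr_le1 Pr mAB; have := fine_Pr_ge0 Pr A'.
have := fine_Pr_ge0 Pr B'; have := fine_Pr_ge0 Pr (A' `&` B').
move: (fine _) (fine _) (fine _) => x y z x0 y0 z0 x1 y1 z1.
rewrite ler_norml; apply/andP; split; nra.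
Qed.

Lemma recent_future n k l (B : set nat) : (k <= n)%N ->
  future u ((n - k) * p)%N [set w | B (cell l (h (\row_i recent n k i w)))].
Proof.
move=> kn; apply: sigma_rv_measurable.
pose D := [set j : int | ((n - k) * p)%N%:Z <= j].
apply: (@measurable_continuous_row _ (g_sigma_algebraType (rv_gen D u)) R p h
  (recent n k) ch) => i.
apply: measurable_funM; first exact: measurable_cst.
rewrite (_ : (fun w => _) = (fun w => \sum_(0 <= q < k)
    ph ^- q.+1 * u (((n - q.+1) * p + i.+1)%N%:Z) w)); last first.
  by apply/funext => w; rewrite big_add1.
suff hm k' : (k' <= k)%N -> measurable_fun
    (setT : set (g_sigma_algebraType (rv_gen D u)))
    ((fun w => \sum_(0 <= q < k') ph ^- q.+1 * u (((n - q.+1) * p + i.+1)%N%:Z) w)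
      : g_sigma_algebraType (rv_gen D u) -> R) by exact: hm.
elim: k' => [|k' IH] k'k.
  rewrite (_ : (fun w => _) = fun=> 0); first exact: measurable_cst.
  by apply/funext => w; rewrite big_geq.
rewrite (_ : (fun w => _) = (fun w => \sum_(0 <= q < k')
    ph ^- q.+1 * u (((n - q.+1) * p + i.+1)%N%:Z) w +
    ph ^- k'.+1 * u (((n - k'.+1) * p + i.+1)%N%:Z) w)); last first.
  by apply/funext => w; rewrite big_nat_recr.
apply: measurable_funD; first exact: IH (ltnW k'k).
apply: measurable_funM; first exact: measurable_cst.
apply: measurable_rv_gen; rewrite /D /= lez_nat.
by rewrite (leq_trans _ (leq_addr _ _))// leq_mul2r leq_sub2l ?orbT.
Qed.

(** The whole weighted sum is asymptotically independent of every event of the past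
    up to a fixed time. *)
Lemma recent_mixing (K : nat) (A : set T) : past X0 u K A ->
  \int[Pr]_w (\1_A w * h (\row_i recent n n i w)) @[n --> \oo] -->
    fine (Pr A) * \int[Pr]_w h (\row_i reversed_limit i w).
Proof.
move=> hA.
have mA : measurable A by apply: sigma_rv_sub hA; exact: measurable_adjoin.
have [M hM] := bounded_fun_norm_le bh.
have bA := @bmeas_indic _ _ R _ mA.
have brec n k : bmeas (fun w => h (\row_i recent n k i w)).
  by apply: bmeas_row => // i; exact: measurable_recent.
have brev k : bmeas (fun w => h (\row_i reversed k i w)).
  by apply: bmeas_row => // i; exact: measurable_reversed.
have blim : bmeas (fun w => h (\row_i reversed_limit i w)).
  by apply: bmeas_row => // i; exact: measurable_reversed_limit.
pose er k := \int[Pr]_w `|h (\row_i reversed k i w) - h (\row_i reversed_limit i w)|.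
have er_cvg : er k @[k --> \oo] --> (0 : R) by exact: reversed_L1_cvg.
have indic_le1 w : `|\1_A w : R| <= 1.
  by rewrite indicE; case: (_ \in _); rewrite ?normr0 ?normr1.
apply/cvgrPdist_le => e e0.
have e8 : 0 < e / 8 by rewrite divr_gt0.
have [k0 _ hk0] : \forall k \near \oo, `|er k| < e / 8.
  by have /cvgr0Pnorm_lt := er_cvg; apply.
have her k : (k0 <= k)%N -> er k <= e / 8.
  by move=> kk; rewrite ltW// (le_lt_trans (ler_norm _))// hk0.
(* The level [l] of quantization has to be chosen before the lag, as the bound
   on the covariance grows with it. *)
have [l [hlM hle]] : exists l : nat, M <= l%:R /\ 2 / l.+1%:R <= e / 8.
  have : \forall l \near \oo, M <= l%:R /\ 2 / l.+1%:R <= e / 8.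
    near=> l; split; first by near: l; exact: nbhs_infty_ger.
    rewrite -ler_pdivlMl// ltW//; near: l.
    by apply: (near_infty_natSinv_lt (PosNum _)); rewrite mulr_gt0 ?invr_gt0.
  by move=> [l _ hl]; exists l; exact: (hl l (leqnn l)).
have e16 : 0 < e / 8 / (2 * l%:R + 1) by rewrite divr_gt0// ltr_wpDl// mulr_ge0.
have [N0 _ hN0] : \forall N \near \oo,
    `|mixing_coef Pr X0 u N| < e / 8 / (2 * l%:R + 1).
  by have /cvgr0Pnorm_lt := mixing; apply.
exists (k0 + (K + N0) + 2)%N => // n /= hn.
have n1 : (1 < n)%N by rewrite (leq_trans _ hn)// addn2.
have k0n : (k0 <= n)%N by rewrite (leq_trans _ hn)// -addnA leq_addr.
have hlag : (K + N0 <= (n - k0) * p)%N.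
  apply: (@leq_trans (n - k0)); last by rewrite leq_pmulr.
  by rewrite leq_subRL// (leq_trans _ hn)// leq_addr.
(* [N] is the gap between the past event and the [k0] most recent periods. *)
pose N := ((n - k0) * p - K)%N.
have NE : ((n - k0) * p = K + N)%N.
  by rewrite /N subnKC// (leq_trans _ hlag)// leq_addr.
have hN : mixing_coef Pr X0 u N <= e / 8 / (2 * l%:R + 1).
  rewrite ltW// (le_lt_trans (ler_norm _))// hN0//=.
  by rewrite /N leq_subRL// (leq_trans _ hlag)// leq_addr.
pose Yn w := h (\row_i recent n n i w).
pose Yk w := h (\row_i recent n k0 i w).
pose Z w := h (\row_i reversed_limit i w).
have s1 : `|\int[Pr]_w (\1_A w * Yn w) - \int[Pr]_w (\1_A w * Yk w)| <= e / 4.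
  rewrite -bRintegralB;
    [|exact: bmeasM bA (brec n n)|exact: bmeasM bA (brec n k0)].
  under eq_Rintegral do rewrite -mulrBr.
  rewrite (le_trans (bRintegral_norm _ (bmeasM bA (bmeasB (brec n n) (brec n k0)))))//.
  apply: (@le_trans _ _ (\int[Pr]_w `|Yn w - Yk w|)).
    apply: bRintegral_le.
    - exact: bmeas_norm (bmeasM bA (bmeasB (brec n n) (brec n k0))).
    - exact: bmeas_norm (bmeasB (brec n n) (brec n k0)).
    - by move=> w; rewrite normrM ler_piMl.
  rewrite /Yn /Yk Rintegral_recent_diff//.
  apply: (@le_trans _ _ (er n + er k0)); last first.
    have := her n k0n; have := her k0 (leqnn _); lra.
  rewrite /er -bRintegralD; [|exact: bmeas_norm (bmeasB (brev _) blim)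
    |exact: bmeas_norm (bmeasB (brev _) blim)].
  apply: bRintegral_le.
  - exact: bmeas_norm (bmeasB (brev _) (brev _)).
  - by apply: bmeasD; exact: bmeas_norm (bmeasB (brev _) blim).
  - move=> w; rewrite [X in _ <= _ + X]distrC -[leLHS]/(`|_ - _|).
    apply: le_trans (ler_normD _ _); rewrite le_eqVlt; apply/orP; left; apply/eqP.
    by congr `|_|; ring.
have s2 : `|\int[Pr]_w (\1_A w * Yk w) - fine (Pr A) * \int[Pr]_w Yk w| <= e / 4.
  apply: (le_trans (@covariance_level_sets _ _ _ Pr A Yk
    (mixing_coef Pr X0 u N) l mA (bmeas_mfun (brec n k0)) _ _)).
  - by move=> w; rewrite (le_trans (hM _)).
  - move=> k /=; apply: (mixing_coef_ge hA); rewrite -NE.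
    exact: (@recent_future n k0 l [set j | (k < j)%N]).
  - have h1 : 2 * l%:R * mixing_coef Pr X0 u N <= e / 8.
      apply: (@le_trans _ _ (2 * l%:R * (e / 8 / (2 * l%:R + 1)))).
        by rewrite ler_wpM2l// mulr_ge0.
      rewrite mulrA ler_pdivrMr ?ltr_wpDl ?mulr_ge0// mulrC ler_pM2l//.
      by rewrite lerDl.
    by rewrite (le_trans (lerD h1 hle))//; lra.
have s3 : `|fine (Pr A) * \int[Pr]_w Yk w - fine (Pr A) * \int[Pr]_w Z w| <= e / 4.
  rewrite /Yk Rintegral_recent// -mulrBr normrM ger0_norm ?fine_Pr_ge0//.
  rewrite (@le_trans _ _ (er k0))//; last by have := her k0 (leqnn _); lra.
  rewrite -[leRHS]mul1r ler_pM ?fine_Pr_ge0 ?fine_Pr_le1// -bRintegralB//.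
  exact: (bRintegral_norm _ (bmeasB (brev _) blim)).
move: s1 s2 s3; rewrite !ler_distl -/(Yn _) => /andP[? ?] /andP[? ?] /andP[? ?].
apply/andP; split; rewrite -/(Yn _); lra.
Unshelve. all: by end_near. Qed.

End Reversal.

(** * Convergence of the estimators *)

Lemma sigma_rv_cell_event (d : measure_display) (T : measurableType d) (R : realType)
    (I : Type) (D : set I) (Y : I -> T -> R) (eta : T -> R) (l k : nat) :
  measurable_fun (setT : set (g_sigma_algebraType (rv_gen D Y)))
    (eta : g_sigma_algebraType (rv_gen D Y) -> R) ->
  sigma_rv D Y (cell_event l k eta).
Proof. exact: (@sigma_rv_measurable _ _ _ _ _ _ eta [set k] l). Qed.

Lemma measurable_par1 (d : measure_display) (T : measurableType d)
    (R : realType) (a : nat -> R) (u : int -> T -> R) (X0 : T -> R) (k : nat) :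
  (forall k, measurable_fun setT (u k)) -> measurable_fun setT X0 ->
  measurable_fun setT (par1 a u X0 k).
Proof.
move=> mu mX0; elim: k => //= k IH.
by apply: measurable_funD => //; exact: measurable_funM.
Qed.

Lemma measurable_lse (d : measure_display) (T : measurableType d)
    (R : realType) (p r n : nat) (X : nat -> T -> R) :
  (forall k, measurable_fun setT (X k)) -> measurable_fun setT (lse p X r n).
Proof.
move=> mX; apply: measurable_funM.
  by apply: measurable_sum => j; exact: measurable_funM.
apply: (measurableT_comp (@measurable_inv R)).
by apply: measurable_sum => j; exact: measurable_funX.
Qed.

(** The inverse of [X0 + Z_l] is determined by the past up to time [(l + 1) * p]. *)
Lemma measurable_Zseq_past (d : measure_display) (T : measurableType d)
    (R : realType) (p : nat) (a : nat -> R) (u : int -> T -> R) (X0 : T -> R)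
    (l : nat) :
  let D := [set o : option int |
    if o is Some j then j <= (l.+1 * p)%N%:Z else true] in
  measurable_fun (setT : set (g_sigma_algebraType (rv_gen D (adjoin X0 u))))
    ((fun w => (X0 w + Zseq p a u l w)^-1) :
      g_sigma_algebraType (rv_gen D (adjoin X0 u)) -> R).
Proof.
move=> D; set T' := g_sigma_algebraType _.
have mX0 : measurable_fun (setT : set T') (X0 : T' -> R).
  exact: (@measurable_rv_gen _ T R _ D (adjoin X0 u) None).
have mu' k : (k <= l.+1 * p)%N -> measurable_fun (setT : set T') (u k%:Z : T' -> R).
  by move=> kl; exact: (@measurable_rv_gen _ T R _ D (adjoin X0 u) (Some k%:Z) kl).
apply: (measurableT_comp (@measurable_inv R)).
apply: measurable_funD => //.
have mU n r : (n <= l)%N -> (r <= p)%N ->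
    measurable_fun (setT : set T') (Useq p a u r n : T' -> R).
  move=> nl; elim: r => [|r IH] rp.
    rewrite (_ : Useq p a u 0 n = fun=> 0); first exact: measurable_cst.
    by apply/funext => w; rewrite /Useq big_geq.
  rewrite (_ : Useq p a u r.+1 n =
    fun w => a r.+1 * Useq p a u r n w + u (n * p + r.+1)%N%:Z w); last first.
    by apply/funext => w; rewrite Useq_recr.
  apply: measurable_funD.
    apply: measurable_funM; [exact: measurable_cst|exact: IH (ltnW rp)].
  apply: mu'; rewrite mulSn addnC leq_add// leq_mul2r nl orbT//.
have mS n : (n <= l.+1)%N -> measurable_fun (setT : set T')
    ((fun w => \sum_(0 <= l < n) phi p a ^- l.+1 * Useq p a u p l w) : T' -> R).
  elim: n => [|n IH] nl.
    rewrite (_ : (fun w => _) = fun=> 0); first exact: measurable_cst.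
    by apply/funext => w; rewrite big_geq.
  rewrite (_ : (fun w => _) =
    fun w => \sum_(0 <= l < n) phi p a ^- l.+1 * Useq p a u p l w
      + phi p a ^- n.+1 * Useq p a u p n w); last first.
    by apply/funext => w; rewrite big_nat_recr.
  apply: measurable_funD; first exact: IH (ltnW nl).
  by apply: measurable_funM; [exact: measurable_cst|exact: mU].
exact: (mS l.+1).
Qed.

(** Independence of an event from the level sets of a bounded function makes
    their covariance vanish. *)
Lemma independent_covariance (d : measure_display) (T : measurableType d)
    (R : realType) (Pr : probability T R) (A : set T) (h : T -> R) :
  measurable A -> bmeas h ->
  (forall (l : nat) (D : set nat),
    (Pr (A `&` [set w | D (cell l (h w))])
      = Pr A * Pr [set w | D (cell l (h w))])%E) ->
  \int[Pr]_w (\1_A w * h w) = fine (Pr A) * \int[Pr]_w h w.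
Proof.
move=> mA bh hind; have [mh [M hM]] := bh.
apply/eqP; rewrite -subr_eq0 -normr_le0; apply/ler_addgt0Pl => e e0; rewrite addr0.
have : \forall l \near \oo, M <= l%:R /\ 2 / l.+1%:R <= e.
  near=> l; split; first by near: l; exact: nbhs_infty_ger.
  rewrite -ler_pdivlMl// ltW//; near: l.
  by apply: (near_infty_natSinv_lt (PosNum _)); rewrite mulr_gt0 ?invr_gt0.
move=> [l _ hl]; have [Ml le] := hl l (leqnn l).
apply: (le_trans (@covariance_level_sets _ _ _ Pr A h 0 l mA mh _ _)).
- by move=> w; rewrite (le_trans (hM _)).
- move=> k /=; rewrite (hind l [set j | (k < j)%N]) fineM ?fin_num_measure//.
    by rewrite subrr normr0.
  exact: (measurable_cell_set l [set j | (k < j)%N]).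
- by rewrite mulr0 add0r.
Unshelve. all: by end_near. Qed.

Unset Implicit Arguments.

Theorem theorem1 (d : measure_display) (T : measurableType d) (R : realType)
    (Pr : probability T R) (p : nat) (a : nat -> R)
    (u : int -> {RV Pr >-> R}) (X0 zeta : {RV Pr >-> R})
    (ustar : nat -> {RV Pr >-> R})
    (p_gt0 : (0 < p)%N)
    (a_periodic : forall k : nat, a (k + p)%N = a k)
    (u_L2 : forall k : int, (u k : T -> R) \in Lfun Pr 2%:E)
    (u_centered : forall k : int, ('E_Pr[u k] = 0)%E)
    (u_periodic : periodically_distributed Pr p u)
    (X0_L2 : (X0 : T -> R) \in Lfun Pr 2%:E)
    (phi_gt1 : 1 < `|phi p a|)
    (zeta_as : {ae Pr, forall w, Zseq p a u n w @[n --> \oo] --> zeta w})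
    (zeta_qm : ('E_Pr[fun w => ((Zseq p a u n w - zeta w) ^+ 2)%R])%E @[n --> \oo]
                 --> 0%E)
    (ustar_reversed : reversed_sequence Pr p X0 u ustar) :
  (forall r : nat, (1 <= r <= p)%N ->
     {ae Pr, forall w, X0 w + zeta w != 0 ->
        lse p (par1 a u X0) r n w @[n --> \oo] --> a r})
  /\
  (Pr [set w | X0 w + zeta w = 0] = 0%E ->
   mixing_coef Pr X0 u n @[n --> \oo] --> 0 ->
   forall zetastar : 'I_p -> {RV Pr >-> R},
     independent_rv Pr zetastar (fun b : bool => if b then X0 else zeta) ->
     same_law Pr zetastar (fun i : 'I_p => zeta_star p a ustar i.+1) ->
     cvg_in_distribution Pr
       (fun (n : nat) (i : 'I_p) (w : T) =>
          phi p a ^+ n * (lse p (par1 a u X0) i.+1 n w - a i.+1))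
       (fun (i : 'I_p) (w : T) =>
          (phi p a ^+ 2 - 1) * zetastar i w
            / (Aprod a 1 i * (X0 w + zeta w)))).

Proof.
have mu k : measurable_fun setT (u k : T -> R) by [].
have mus k : measurable_fun setT (ustar k : T -> R) by [].
have mX0 : measurable_fun setT (X0 : T -> R) by [].
(* Any [rho > 1] with [rho ^+ 2 < `|phi p a|] will do. *)
pose rho := Num.sqrt (Num.sqrt `|phi p a|).
have rho1 : 1 < rho.
  rewrite -[ltLHS](@sqrtr1 R) ltr_sqrt ?sqrtr_gt0 ?(lt_trans _ phi_gt1)//.
  by rewrite -[ltLHS](@sqrtr1 R) ltr_sqrt// (lt_trans _ phi_gt1).
have phi0 : 0 < `|phi p a| by rewrite (lt_trans _ phi_gt1).
have pn0 : phi p a != 0 by rewrite -normr_gt0.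
have rho2phi : rho ^+ 2 < `|phi p a|.
  rewrite /rho sqr_sqrtr// -[ltRHS](@sqr_sqrtr R `|phi p a|)//.
  rewrite ltr_eXnr// -[ltLHS](@sqrtr1 R) ltr_sqrt//.
have [C hC] := periodic_mean_le p_gt0 mu u_L2 u_periodic.
have growth : {ae Pr, forall w, forall s : nat,
    geoO rho (fun j => u (j * p + s)%N%:Z w)}.
  by apply: ae_foralln => s; apply: (mean_le_geoO rho1) => j; exact: hC.
split.
  move=> r rp; apply: filterS2 growth zeta_as => w hu hZ V0.
  exact: (lse_cvg a_periodic rho1 rho2phi (fun s _ => hu s) hZ V0 rp).
move=> V0 mixing zetastar zs_indep zs_law.
have [_ urev] := ustar_reversed.
(* [ustar k] has the law of a noise variable: this is seen on a window longer
   than [k]. *)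
have hCs k : mean_le Pr (ustar k) C.
  have hk : (k < k.+2 * p)%N by rewrite (leq_trans _ (leq_pmulr _ p_gt0)).
  exact: (@same_law_mean_le _ _ _ _ _ _ _ (Ordinal hk) C
    (fun i => mus _) (fun i => mu _) (urev k.+2 isT) (hC _)).
pose c (i : 'I_p) := (phi p a ^+ 2 - 1) / Aprod a 1 i.
pose Y n i w := recent (phi p a) c u n n i w.
pose H n (i : 'I_p) w :=
  phi p a ^+ n * (lse p (par1 a u X0) i.+1 n w - a i.+1).
pose eta w := (X0 w + zeta w)^-1.
pose eta_ l w := (X0 w + Zseq p a u l w)^-1.
pose zs i w := c i * zetastar i w.
have YE n i w : Y n i w = c i * geo_sum (phi p a) (fun j => u (j * p + i.+1)%N%:Z w) n.
  by rewrite /Y /recent geo_sum_rev.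
have mY n i : measurable_fun setT (Y n i) by exact: measurable_recent.
have mH n i : measurable_fun setT (H n i).
  apply: measurable_funM => //; apply: measurable_funB => //.
  by apply: measurable_lse => k; exact: measurable_par1.
have meta : measurable_fun setT eta.
  by apply: (measurableT_comp (@measurable_inv R)); exact: measurable_funD.
have mZ l : measurable_fun setT (Zseq p a u l).
  apply: measurable_sum => k; apply: measurable_funM => //.
  by apply: measurable_sum => s; exact: measurable_funM.
have meta_ l : measurable_fun setT (eta_ l).
  by apply: (measurableT_comp (@measurable_inv R)); exact: measurable_funD.
have mzs i : measurable_fun setT (zs i) by exact: measurable_funM.
have tY : tight Pr (fun n => l1norm (Y n)).
  pose B := \sum_(i < p) `|c i| * (C / (`|phi p a| - 1)).
  apply: (@mean_le_tight _ _ _ _ _ B) => n; apply: mean_le_l1norm => i.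
  rewrite (_ : Y n i = fun w => c i * geo_sum (phi p a)
    (fun j => u (j * p + i.+1)%N%:Z w) n); last by apply/funext => w; exact: YE.
  apply: mean_leZ; apply: (mean_le_geo_sum phi_gt1
    (e := fun j w => u (j * p + i.+1)%N%:Z w)) => j; exact: hC.
have aeV : {ae Pr, forall w, X0 w + zeta w != 0}.
  have mV : measurable [set w | X0 w + zeta w = 0].
    have mXz : measurable_fun setT (fun w => X0 w + zeta w) by exact: measurable_funD.
    by have := mXz measurableT [set 0] (measurable_set1 0); rewrite setTI.
  by exists [set w | X0 w + zeta w = 0]; split => // w /= /negP; rewrite negbK => /eqP.
have heta : {ae Pr, forall w, eta_ l w @[l --> \oo] --> eta w}.
  apply: filterS2 aeV zeta_as => w Vw hZ.
  by apply: cvgV => //; apply: cvgD hZ; exact: cvg_cst.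
have hH : {ae Pr, forall w, forall i, H n i w - eta w * Y n i w @[n --> \oo] --> 0}.
  apply: filterS3 aeV growth zeta_as => w Vw hu hZ i.
  have := @lse_error _ _ _ _ _ _ a_periodic _ _ _ rho1 rho2phi
    (fun s _ => hu s) hZ Vw i.+1 (ltn_ord i).
  apply: cvg_trans; apply: near_eq_cvg; apply: nearW => n.
  by rewrite YE /H /eta /c /= invfM; congr (_ - _); ring.
have hmix l k (g : 'rV[R]_p -> R) : continuous g -> bounded_fun g ->
    \int[Pr]_w (\1_(cell_event l k (eta_ l)) w * g (\row_i Y n i w)) @[n --> \oo] -->
      fine (Pr (cell_event l k (eta_ l))) * \int[Pr]_w g (\row_i zs i w).
  move=> cg bg.
  have -> : \int[Pr]_w g (\row_i zs i w) =
      \int[Pr]_w g (\row_i reversed_limit (phi p a) c ustar i w).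
    have mzst (i : 'I_p) : measurable_fun setT (zeta_star p a ustar i.+1).
      apply: measurable_limn => n; apply: measurable_sum => j.
      exact: measurable_funM.
    have bg' : bmeas (fun t : p.-tuple R => g (\row_i (c i * tnth t i))).
      apply: bmeas_row => // i; apply: measurable_funM => //.
      exact: measurable_tnth.
    have mzt (i : 'I_p) : measurable_fun setT (zetastar i : T -> R) by [].
    have := same_law_Rintegral mzt mzst zs_law bg'.
    move=> e; transitivity (\int[Pr]_w g
        (\row_i (c i * tnth [tuple zetastar j w | j < p] i))).
      apply: eq_Rintegral => w _; congr g; apply/rowP => i.
      by rewrite !mxE tnth_mktuple.
    rewrite e; apply: eq_Rintegral => w _; congr g; apply/rowP => i.
    by rewrite !mxE tnth_mktuple.
  have hA : past X0 u (l.+1 * p) (cell_event l k (eta_ l)).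
    by apply: sigma_rv_cell_event; exact: (@measurable_Zseq_past _ T R p a u X0 l).
  exact: (recent_mixing (c := c) mu mus p_gt0 phi_gt1 urev cg bg hCs mX0 mixing hA).
have hind l k (g : 'rV[R]_p -> R) : continuous g -> bounded_fun g ->
    \int[Pr]_w (\1_(cell_event l k eta) w * g (\row_i zs i w))
    = fine (Pr (cell_event l k eta)) * \int[Pr]_w g (\row_i zs i w).
  move=> cg bg; apply: independent_covariance.
  - exact: measurable_cell_event.
  - exact: bmeas_row.
  move=> l' D; rewrite setIC muleC; apply: zs_indep.
    apply: sigma_rv_measurable.
    apply: (@measurable_continuous_row _ (g_sigma_algebraType (rv_gen setT
      (fun i : 'I_p => zetastar i : T -> R))) R p g zs cg) => i.
    apply: measurable_funM; first exact: measurable_cst.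
    exact: (@measurable_rv_gen _ T R _ setT (fun i : 'I_p => zetastar i : T -> R) i).
  apply: sigma_rv_cell_event; apply: (measurableT_comp (@measurable_inv R)).
  pose W := fun b : bool => (if b then X0 else zeta) : T -> R.
  apply: measurable_funD.
    exact: (@measurable_rv_gen _ T R _ setT W true).
  exact: (@measurable_rv_gen _ T R _ setT W false).
move=> f cf bf.
have mlim (i : 'I_p) : measurable_fun setT (fun w => eta w * zs i w).
  exact: measurable_funM.
have limE : (fun w => f (\row_i ((phi p a ^+ 2 - 1) * zetastar i w
    / (Aprod a 1 i * (X0 w + zeta w))))) = (fun w => f (\row_i (eta w * zs i w))).
  apply/funext => w; congr f; apply/rowP => i; rewrite !mxE /eta /zs /c invfM.
  by ring.
rewrite limE expectation_bmeas; last exact: bmeas_row.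
under eq_fun do rewrite (expectation_bmeas _ (bmeas_row cf bf (mH _))).
apply: cvg_EFin; first exact: nearW.
exact: (mixing_limit cf bf mzs meta mY mH meta_ tY heta hH hmix hind).
Qed.
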